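(* Up to isomorphism, there are exactly $13$ centrally nilpotent right Bol loops of order $3^3$, exactly $15$ of order $5^3$, and exactly $17$ of order $7^3$.
   Context: A loop is a set with a binary multiplication and a two-sided identity $1$ in which all left and right translations are bijections. A loop is right Bol if it satisfies $((xy)z)y=x((yz)y)$ for all $x,y,z$. The center $Z(Q)$ is the set of elements $x$ with $x\cdot yz=xy\cdot z$, $y\cdot xz=yx\cdot z$, $y\cdot zx=yz\cdot x$ and $xy=yx$ for all $y,z\in Q$; it is a normal subloop. $Q$ is centrally nilpotent if the series $Q,\ Q/Z(Q),\ (Q/Z(Q))/Z(Q/Z(Q)),\dots$ reaches the trivial loop after finitely many steps. *)

(* Defs.v *)
From mathcomp Require Import all_boot.
Set Implicit Arguments. Unset Strict Implicit. Unset Printing Implicit Defensive.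

Record magma := Magma {
  mcar : finType;
  mmul : mcar -> mcar -> mcar;
  mone : mcar }.

Section MagmaDefs.
Variable M : magma.
Local Notation T := (mcar M).
Local Notation "x * y" := (mmul x y).

Definition is_loop : Prop :=
  (forall x : T, mone M * x = x /\ x * mone M = x) /\
  (forall a : T, bijective (fun x => a * x)) /\
  (forall a : T, bijective (fun x => x * a)).

Definition right_bol : Prop :=
  forall x y z : T, ((x * y) * z) * y = x * ((y * z) * y).

Definition center : {set T} :=
  [set x | [forall y, [forall z,
     [&& x * (y * z) == (x * y) * z,
         y * (x * z) == (y * x) * z,
         y * (z * x) == (y * z) * x &
         x * y == y * x]]]].

(* Cosets xN of a subset N, and the quotient magma Q/N
   (for a normal subloop N this is the usual quotient loop). *)
Definition lcoset (N : {set T}) (x : T) : {set T} := [set x * n | n in N].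
Definition is_coset (N : {set T}) (A : {set T}) : bool :=
  [exists x, A == lcoset N x].

Lemma lcoset_is_coset (N : {set T}) x : is_coset N (lcoset N x).
Proof. by apply/existsP; exists x. Qed.

Definition qcar (N : {set T}) : finType := {A : {set T} | is_coset N A}.
Definition qrep (N : {set T}) (A : qcar N) : T := odflt (mone M) [pick x in val A].
Definition qelt (N : {set T}) (x : T) : qcar N :=
  exist _ (lcoset N x) (lcoset_is_coset N x).
Definition quot (N : {set T}) : magma :=
  @Magma (qcar N) (fun A B => qelt N (qrep A * qrep B)) (qelt N (mone M)).

End MagmaDefs.

Inductive centrally_nilpotent : magma -> Prop :=
| cn_trivial M : #|mcar M| = 1 -> centrally_nilpotent M
| cn_step M : centrally_nilpotent (quot (center M)) -> centrally_nilpotent M.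

Definition isomorphic (M M' : magma) : Prop :=
  exists f : mcar M -> mcar M',
    bijective f /\ forall x y, f (mmul x y) = mmul (f x) (f y).

Definition cn_right_bol_loop (M : magma) : Prop :=
  [/\ is_loop M, right_bol M & centrally_nilpotent M].

Definition num_iso_classes (P : magma -> Prop) (k : nat) : Prop :=
  exists L : 'I_k -> magma,
    [/\ forall i, P (L i),
        forall i j, isomorphic (L i) (L j) -> i = j &
        forall M, P M -> exists i, isomorphic M (L i)].

(* Main.v *)
From mathcomp Require Import all_boot all_algebra fingroup cyclic ring.
Require Import Defs.
Set Implicit Arguments. Unset Strict Implicit. Unset Printing Implicit Defensive.

(** A right Bol loop is right power-alternative, so if [Q / Z(Q)] is generated by
    one element then [Q] is an abelian group. Hence a centrally nilpotent right Bol
    loop [Q] of order [p^3] is either cyclic or has a central subgroup [<z>] of order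
    [p] with elementary abelian quotient of order [p^2].

    In the latter case write [(xu)w = ((xw)u) z^K(x)] for fixed [u], [w]. Since
    [R_w R_u^2 R_w] and [R_u R_w^2 R_u] are right translations by elements that agree
    modulo [z], [K(xwu) - K(x)] is constant; the same for [u^-1] shows that [K] is an
    affine function on [Q / <z>]. As [x((b^m a^k)b^m) = ((x b^m)a^k)b^m] and [2] is
    invertible modulo [p], the right translations by two generators [a], [b] determine
    the product. Choosing [b] in the kernel of the linear part of [K] gives
    [Q] the coordinates [a^i b^j z^c] and an explicit cocycle with four parameters:
    [lam] (associators), [om] (commutators), [al] and [be] (p-th powers).

    An isomorphism between two such loops is a change of [a], [b], [z]; its effect on
    the parameters is read off from [K] and from the p-th power map, which leaves
    [p + 9] classes besides the cyclic group. *)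

Import GRing.Theory.
Local Notation "x ** y" := (mmul x y) (at level 40, left associativity).

(** * Loops, centers and central quotients *)

Definition pow (M : magma) (x : mcar M) (n : nat) : mcar M :=
  iter n (fun y => y ** x) (mone M).

Lemma pow0 (M : magma) (x : mcar M) : pow x 0 = mone M. Proof. by []. Qed.
Lemma powS (M : magma) (x : mcar M) n : pow x n.+1 = pow x n ** x. Proof. by []. Qed.

Section Loop.
Variable M : magma.
Hypothesis loopM : is_loop M.
Local Notation T := (mcar M).
Local Notation e := (mone M).

Lemma mul1 (x : T) : e ** x = x. Proof. by case: loopM => H _; case: (H x). Qed.
Lemma mulx1 (x : T) : x ** e = x. Proof. by case: loopM => H _; case: (H x). Qed.

Lemma loopI (a x y : T) : a ** x = a ** y -> x = y.
Proof. by case: loopM => _ [H _]; move/(bij_inj (H a)). Qed.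

Lemma loopIr (a x y : T) : x ** a = y ** a -> x = y.
Proof. by case: loopM => _ [_ H]; move/(bij_inj (H a)). Qed.

Lemma pow1 (x : T) : pow x 1 = x. Proof. exact: mul1. Qed.
Lemma pow_e n : pow e n = e.
Proof. by elim: n => // n IH; rewrite powS IH mul1. Qed.

Lemma centerP (z : T) :
  reflect (forall x y, [/\ z ** (x ** y) = (z ** x) ** y,
                           x ** (z ** y) = (x ** z) ** y,
                           x ** (y ** z) = (x ** y) ** z & z ** x = x ** z])
          (z \in center M).
Proof.
rewrite inE; apply: (iffP forallP) => H x.
  by move=> y; have /forallP/(_ y)/and4P[/eqP ? /eqP ? /eqP ? /eqP ?] := H x.
apply/forallP => y; have [? ? ? ?] := H x y.
by apply/and4P; split; apply/eqP.
Qed.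

Lemma center1 : e \in center M.
Proof. by apply/centerP => x y; rewrite !mul1 !mulx1. Qed.

Lemma ctrC z x : z \in center M -> z ** x = x ** z.
Proof. by move/centerP/(_ x x) => []. Qed.

Lemma ctrA z x y : z \in center M -> x ** (y ** z) = (x ** y) ** z.
Proof. by move/centerP/(_ x y) => []. Qed.

Lemma ctrM z x y : z \in center M -> (x ** z) ** y = (x ** y) ** z.
Proof. by move=> zC; case/centerP/(_ x y): (zC) => _ <- _ _; rewrite (ctrC y zC) ctrA. Qed.

Lemma center_mul z w : z \in center M -> w \in center M -> z ** w \in center M.
Proof.
move=> zC wC; apply/centerP => x y.
have Cr u : u ** (z ** w) = u ** z ** w by rewrite ctrA.
have Cl u : (z ** w) ** u = u ** z ** w by rewrite (ctrM _ _ wC) (ctrC u zC).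
split; rewrite ?Cl ?Cr //.
- by rewrite (ctrM _ y wC) (ctrM x y zC).
- by rewrite (ctrA x _ wC) (ctrA x y zC) (ctrM _ y wC) (ctrM x y zC).
- by rewrite (ctrA _ _ wC) (ctrA _ _ zC).
Qed.

Lemma center_pow z n : z \in center M -> pow z n \in center M.
Proof.
move=> zC; elim: n => [|n IH]; first exact: center1.
by rewrite powS center_mul.
Qed.

Lemma center_cancel z x : z \in center M -> x ** z \in center M -> x \in center M.
Proof.
move=> zC xzC; apply/centerP => u v; split; apply: (@loopIr z).
- have [H _ _ _] := centerP _ xzC u v.
  by move: H; rewrite !(ctrM _ _ zC).
- have [_ H _ _] := centerP _ xzC u v.
  by move: H; rewrite (ctrM _ _ zC) !(ctrA _ _ zC) (ctrM _ _ zC).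
- have [_ _ H _] := centerP _ xzC u v.
  by move: H; rewrite !(ctrA _ _ zC).
- by have := ctrC u xzC; rewrite (ctrM _ _ zC) (ctrA _ _ zC).
Qed.

(** Left division stays inside the center by [center_cancel]; this makes two cosets of the center
    that share an element equal. *)
Lemma center_div x y : x \in center M -> y \in center M ->
  exists2 z, z \in center M & x = y ** z.
Proof.
move=> xC yC; case: loopM => _ [H _]; have [g gK Kg] := H y.
exists (g x); last by rewrite Kg.
by apply: (center_cancel yC); rewrite -(ctrC _ yC) Kg.
Qed.

Lemma qeltP x y :
  reflect (exists2 z, z \in center M & y = x ** z) (qelt (center M) x == qelt (center M) y).
Proof.
rewrite -(inj_eq val_inj) /=; apply: (iffP eqP) => [E|[z zC ->]].
  have : y \in lcoset (center M) y by apply/imsetP; exists e; rewrite ?center1 ?mulx1.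
  by rewrite -E => /imsetP[z zC ->]; exists z.
apply/setP => u; apply/imsetP/imsetP => -[w wC ->].
  have [v vC ->] := center_div wC zC.
  by exists v => //; rewrite ctrA.
by exists (z ** w); rewrite ?center_mul // ctrA.
Qed.

Lemma qeltE x y z : z \in center M -> y = x ** z -> qelt (center M) x = qelt (center M) y.
Proof. by move=> zC yE; apply/eqP/qeltP; exists z. Qed.

Lemma qrepK (A : qcar (center M)) : qelt (center M) (qrep A) = A.
Proof.
case: A => A Aco; rewrite /qrep /=; case: pickP => [x xA|A0].
  case/existsP: (Aco) => y /eqP AE; apply/eqP; rewrite -(inj_eq val_inj) /=.
  move: xA; rewrite AE => /imsetP[z zC xE].
  by apply/eqP/esym; have := qeltE zC xE => /(congr1 val).
case/existsP: (Aco) => y /eqP AE; suff : y \in A by rewrite A0.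
by rewrite AE; apply/imsetP; exists e; rewrite ?center1 ?mulx1.
Qed.

(** The quotient multiplies chosen representatives; another choice contributes only central factors,
    which can all be moved to the right end. *)
Lemma qeltM x y : mmul (qelt (center M) x : mcar (quot (center M))) (qelt (center M) y)
  = qelt (center M) (x ** y).
Proof.
apply/eqP; rewrite eq_sym; apply/qeltP.
have /eqP/qeltP[u uC ->] := esym (qrepK (qelt (center M) x)).
have /eqP/qeltP[v vC ->] := esym (qrepK (qelt (center M) y)).
exists (v ** u); first exact: center_mul.
by rewrite !(ctrM _ _ uC) !(ctrA _ _ vC) ctrA // ctrM.
Qed.

Lemma quot_elim (A : mcar (quot (center M))) : exists x, A = qelt (center M) x.
Proof. by exists (qrep A); rewrite qrepK. Qed.

Lemma quot_loop : is_loop (quot (center M)).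
Proof.
split; last split.
- move=> A; have [x ->] := quot_elim A.
  by rewrite [mone _]/(qelt _ _) !qeltM mul1 mulx1.
- move=> A; apply: injF_bij => B C; have [x ->] := quot_elim A.
  have [y ->] := quot_elim B; have [w ->] := quot_elim C.
  rewrite !qeltM => /eqP/qeltP[z zC E]; apply: (qeltE zC).
  by apply: (@loopI x); rewrite ctrA.
- move=> A; apply: injF_bij => B C; have [x ->] := quot_elim A.
  have [y ->] := quot_elim B; have [w ->] := quot_elim C.
  rewrite !qeltM => /eqP/qeltP[z zC E]; apply: (qeltE zC).
  by apply: (@loopIr x); rewrite ctrM.
Qed.

Lemma quot_bol : right_bol M -> right_bol (quot (center M)).
Proof.
move=> bolM A B C; have [x ->] := quot_elim A.
have [y ->] := quot_elim B; have [z ->] := quot_elim C.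
by rewrite !qeltM bolM.
Qed.

Lemma card_quot : #|T| = (#|mcar (quot (center M))| * #|center M|)%N.
Proof.
rewrite -[LHS]sum1_card (partition_big (qelt (center M)) xpredT) //=.
rewrite -[RHS]sum_nat_const; apply: eq_bigr => A _.
have [x ->] := quot_elim A; rewrite sum1_card -[RHS](card_imset _ (@loopI x)).
apply: eq_card => y; rewrite -[LHS]/(_ == _) eq_sym; apply/qeltP/imsetP => -[z zC ->];
  by exists z.
Qed.

Lemma qelt_pow x n : pow (qelt (center M) x : mcar (quot (center M))) n = qelt (center M) (pow x n).
Proof. by elim: n => // n IH; rewrite !powS IH qeltM. Qed.

End Loop.

Lemma iso_center (M M' : magma) (f : mcar M -> mcar M') : bijective f ->
  (forall x y, f (x ** y) = f x ** f y) ->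
  forall x, (x \in center M) = (f x \in center M').
Proof.
move=> bf fM x; have fI := bij_inj bf; case: bf => g gK Kg.
apply/centerP/centerP => H.
  move=> u v; rewrite -[u]Kg -[v]Kg -!fM.
  by have [-> -> -> ->] := H (g u) (g v).
by move=> u v; have := H (f u) (f v); rewrite -!fM => -[/fI-> /fI-> /fI-> /fI->].
Qed.

Lemma iso_sym M M' : isomorphic M M' -> isomorphic M' M.
Proof.
case=> f [bf fM]; have fI := bij_inj bf; case: (bf) => g gK Kg.
exists g; split; first by exists f.
by move=> x y; apply: fI; rewrite fM !Kg.
Qed.

Lemma iso_trans M M' M'' : isomorphic M M' -> isomorphic M' M'' -> isomorphic M M''.
Proof.
case=> f [bf fM] [g [bg gM]]; exists (g \o f); split; first exact: bij_comp.
by move=> x y; rewrite /= fM gM.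
Qed.

(** If the center is trivial, [qelt] is an isomorphism onto the central quotient, whose center is
    then trivial too. Induction carries this down to the trivial loop ending the series. *)
Lemma cn_center1 M : centrally_nilpotent M -> is_loop M ->
  #|center M| = 1 -> #|mcar M| = 1.
Proof.
elim=> // {}M _ IH loopM Z1.
have ZE z : z \in center M -> z = mone M.
  move/eqP/cards1P: Z1 => [w wE]; have := center1 loopM.
  by rewrite wE !inE => /eqP-> /eqP->.
have qI : injective (qelt (center M)).
  by move=> x y /eqP/(qeltP loopM)[z /ZE-> ->]; rewrite mulx1.
have bq : bijective (qelt (center M) : mcar M -> mcar (quot (center M))).
  exists (@qrep _ _) => A; last exact: qrepK.
  by apply: qI; rewrite qrepK.
rewrite -(bij_eq_card bq) in IH *; apply: (IH (quot_loop loopM)).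
rewrite -Z1 -[RHS](card_imset _ (bij_inj bq)); apply: eq_card => A.
have [x ->] := quot_elim loopM A; rewrite (mem_imset _ _ (bij_inj bq)).
by rewrite -(iso_center bq) // => u v; rewrite qeltM.
Qed.

Lemma cn_abelian M : is_loop M -> center M = [set: mcar M] -> centrally_nilpotent M.
Proof.
move=> loopM ZT; apply: cn_step; apply: cn_trivial.
have := card_quot loopM; rewrite ZT cardsT => E; apply/eqP.
rewrite -(eqn_pmul2r (m := #|mcar M|)) ?mul1n -?E //.
by apply/card_gt0P; exists (mone M).
Qed.

Lemma center_setT M : (forall x y : mcar M, x ** y = y ** x) ->
  (forall x y z : mcar M, (x ** y) ** z = x ** (y ** z)) -> center M = [set: mcar M].
Proof.
move=> C A; apply/setP => x; rewrite in_setT; apply/centerP => y z.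
by rewrite !A; split=> //; apply: C.
Qed.

(** With commutators and associators central, the central quotient is an abelian group, hence equal
    to its own center. *)
Lemma cn_class2 M : is_loop M ->
  (forall x y : mcar M, exists2 z, z \in center M & x ** y = (y ** x) ** z) ->
  (forall x y w : mcar M, exists2 z, z \in center M & (x ** y) ** w = (x ** (y ** w)) ** z) ->
  centrally_nilpotent M.
Proof.
move=> loopM C A; apply: cn_step; apply: cn_abelian; first exact: quot_loop.
apply: center_setT => [P Q|P Q R].
  have [x ->] := quot_elim loopM P; have [y ->] := quot_elim loopM Q.
  by rewrite !qeltM //; have [z zC E] := C x y; rewrite (qeltE loopM zC E).
have [x ->] := quot_elim loopM P; have [y ->] := quot_elim loopM Q.
have [w ->] := quot_elim loopM R.
by rewrite !qeltM //; have [z zC E] := A x y w; rewrite (qeltE loopM zC E).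
Qed.

(** * Right Bol loops of prime power order *)

(** Length of the cycle of the right translation by [x] through 1, so that the orbit theory of
    finite maps applies directly. *)
Definition ord (M : magma) (x : mcar M) : nat :=
  fingraph.order (fun w => w ** x) (mone M).

Section Bol.
Variable M : magma.
Hypotheses (loopM : is_loop M) (bolM : right_bol M).
Local Notation T := (mcar M).
Local Notation e := (mone M).
Implicit Types x y z w : T.

(* The Bol identity gives R_(x^(n+2)) = R_x R_(x^n) R_x. *)
Lemma mul_pow y x n : y ** pow x n = iter n (fun w => w ** x) y.
Proof.
elim/ltn_ind: n y => -[|[|n]] IH y; first exact: mulx1.
  by rewrite pow1.
have -> : pow x n.+2 = (x ** pow x n) ** x.
  by rewrite IH // powS /pow iterSr mul1.
by rewrite -bolM IH // -iterSr.
Qed.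

Lemma mul_powD y x m n : (y ** pow x m) ** pow x n = y ** pow x (m + n).
Proof. by rewrite !mul_pow addnC iterD. Qed.

Lemma mul_powS y x n : (y ** pow x n) ** x = y ** pow x n.+1.
Proof. by rewrite !mul_pow. Qed.

Lemma mul_powSr y x n : (y ** x) ** pow x n = y ** pow x n.+1.
Proof. by rewrite !mul_pow -iterSr. Qed.

Lemma powD x m n : pow x m ** pow x n = pow x (m + n).
Proof. by rewrite -[pow x m](mul1 loopM) mul_powD mul1. Qed.

Lemma powM x m n : pow (pow x m) n = pow x (m * n).
Proof. by elim: n => [|n IH]; rewrite ?muln0 // powS IH powD mulnSr. Qed.

Lemma iter_pow x n : iter n (fun w => w ** x) e = pow x n. Proof. by []. Qed.

Let rI x : injective (fun w => w ** x). Proof. by move=> u v; apply: loopIr. Qed.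

Lemma ord_gt0 x : 0 < ord x. Proof. exact: fingraph.order_gt0. Qed.

(** By [mul_pow], left translation by [y] carries the cycle of R_x through 1 onto the cycle through
    [y]. All cycles of R_x thus have equal length, which gives Lagrange's theorem for elements in
    [ord_dvd]. *)
Lemma order_mulr x y : fingraph.order (fun w => w ** x) y = ord x.
Proof.
rewrite /ord /fingraph.order -[RHS](card_image (@loopI _ loopM y)); apply: eq_card => w.
apply/idP/imageP => [/iter_findex <-|[v]].
  exists (pow x (findex (fun w => w ** x) y w)); last by rewrite mul_pow.
  exact: fconnect_iter.
by move/iter_findex => <- ->; rewrite iter_pow mul_pow; apply: fconnect_iter.
Qed.

Lemma ord_dvd x : ord x %| #|T|.
Proof.
apply/dvdnP; exists (fcard (fun w => w ** x) T); apply/esym.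
rewrite fcard_order_set //; last by apply/subsetP => y _; rewrite inE order_mulr.
Qed.

Lemma pow_ord x : pow x (ord x) = e.
Proof. exact: (iter_order (@rI x)). Qed.

Lemma pow_mod x n : pow x n = pow x (n %% ord x).
Proof.
by rewrite {1}(divn_eq n (ord x)) -powD mulnC -powM pow_ord pow_e // mul1.
Qed.

Lemma pow_inj x i j : i < ord x -> j < ord x -> pow x i = pow x j -> i = j.
Proof.
move=> li lj E; rewrite -(findex_iter li) -(findex_iter lj).
by rewrite !iter_pow E.
Qed.

Lemma pow_eq1 x n : pow x n = e -> ord x %| n.
Proof.
rewrite pow_mod => E; rewrite /dvdn; apply/eqP/(@pow_inj x) => //.
  by rewrite ltn_pmod // ord_gt0.
exact: ord_gt0.
Qed.

Lemma ord_eq1 x : ord x = 1 -> x = e.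
Proof. by move=> E; have := pow_ord x; rewrite E pow1. Qed.

Lemma ord_sub x (A : {pred T}) : (forall i, pow x i \in A) ->
  ord x <= #|A| /\ (ord x = #|A| -> forall y, y \in A -> exists i, y = pow x i).
Proof.
move=> xA; have sA : fconnect (fun w => w ** x) e \subset A.
  by apply/subsetP => y /iter_findex <-; apply: xA.
split; first exact: subset_leq_card.
move=> E y yA; have : y \in fconnect (fun w => w ** x) e.
  by rewrite (elimT (subset_cardP E) sA).
by move/iter_findex => <-; exists (findex (fun w => w ** x) e y).
Qed.

Lemma pow_onto x : ord x = #|T| -> forall y, exists i, y = pow x i.
Proof. by move=> E y; have [_ /(_ E)] := @ord_sub x T (fun _ => isT); apply. Qed.

(** Elements a^i z with z central multiply by adding the exponents of a, because powers of one
    element associate. *)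
Lemma center_cyclic a :
  (forall x, exists i, exists2 z, z \in center M & x = pow a i ** z) ->
  center M = [set: T].
Proof.
move=> gen.
have mulE i j z w : z \in center M -> w \in center M ->
    (pow a i ** z) ** (pow a j ** w) = pow a (i + j) ** (z ** w).
  by move=> zC wC; rewrite !(ctrA _ _ wC) (ctrM _ _ zC) powD.
apply: center_setT => [x y|x y u].
  have [i [z zC ->]] := gen x; have [j [w wC ->]] := gen y.
  by rewrite !mulE // addnC (ctrC w zC).
have [i [z zC ->]] := gen x; have [j [w wC ->]] := gen y.
have [k [v vC ->]] := gen u.
by rewrite (mulE i j) // (mulE (i + j) k) ?center_mul // (mulE j k) // (mulE i) ?center_mul // addnA (ctrA z w vC).
Qed.

Lemma prime_pow_ord p k x : prime p -> #|T| = p ^ k -> exists2 m, m <= k & ord x = p ^ m.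
Proof. by move=> pp E; apply/(dvdn_pfactor _ _ pp); rewrite -E ord_dvd. Qed.

End Bol.

(** * Centers of loops of prime power order *)

Section Reduction.
Variables (M : magma) (p : nat).
Hypotheses (loopM : is_loop M) (bolM : right_bol M) (pp : prime p).
Local Notation T := (mcar M).
Local Notation e := (mone M).
Implicit Types x y z w : T.

Lemma center_quot_cyclic (A : mcar (quot (center M))) :
  (forall B, exists i, B = pow A i) -> center M = [set: T].
Proof.
have [a ->] := quot_elim loopM A => gen; apply: (@center_cyclic _ _ _ a) => // x.
have [i] := gen (qelt (center M) x); rewrite (qelt_pow loopM) => /esym/eqP.
by move/(qeltP loopM) => [z zC E]; exists i, z.
Qed.

(** A nonidentity element of the quotient has order p by [ord_dvd], so it generates the quotient. *)
Lemma center_quot_prime : #|mcar (quot (center M))| = p -> center M = [set: T].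
Proof.
move=> E; have /card_gt1P[A [B [_ _ AB]]] : 1 < #|mcar (quot (center M))|.
  by rewrite E prime_gt1.
have [C C1] : exists C, C != mone (quot (center M)).
  have [A1|] := eqVneq A (mone (quot (center M))); last by exists A.
  by exists B; rewrite -A1 eq_sym.
have qL := quot_loop loopM; have qB := quot_bol loopM bolM.
apply: (@center_quot_cyclic C) => D; apply: pow_onto => //.
have [|m] := @prime_pow_ord _ qL qB p 1 C pp; first by rewrite expn1.
case: m => [|[|m]] // _ Em; last by rewrite Em E.
by rewrite (ord_eq1 qL Em) eqxx in C1.
Qed.

Lemma card_center k : #|T| = p ^ k -> exists2 m, m <= k & #|center M| = p ^ m.
Proof. by move=> E; apply/(dvdn_pfactor _ _ pp); rewrite -E (card_quot loopM) dvdn_mull. Qed.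

Lemma card_quot_center k m : #|T| = p ^ k -> m <= k -> #|center M| = p ^ m ->
  #|mcar (quot (center M))| = p ^ (k - m).
Proof.
move=> E mk Em; have := card_quot loopM; rewrite E Em -{1}(subnK mk) expnD => /eqP.
by rewrite eqn_pmul2r ?expn_gt0 ?prime_gt0 // => /eqP.
Qed.

Lemma cn_center_gt1 k : 0 < k -> #|T| = p ^ k -> centrally_nilpotent M -> 1 < #|center M|.
Proof.
move=> k0 E cnM; have := cn_center1 cnM loopM.
have : 0 < #|center M| by apply/card_gt0P; exists e; apply: center1.
case: #|center M| => [|[|n]] // _ /(_ erefl) E1.
by have := ltn_exp2r 1 p k0; rewrite exp1n -E E1 (prime_gt1 pp).
Qed.

(** The center is nontrivial; if its order were only p, the quotient would have order p and the
    previous criterion would apply. *)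
Lemma cn_card_p2 : #|T| = p ^ 2 -> centrally_nilpotent M -> center M = [set: T].
Proof.
move=> E cnM; have := @cn_center_gt1 2 isT E cnM; have [m m2 Em] := card_center E.
rewrite Em; case: m m2 Em => [|[|[|]]] // m2 Em _.
  by apply: center_quot_prime; rewrite (card_quot_center E m2 Em).
by apply/eqP; rewrite eqEcard subsetT cardsT Em E leqnn.
Qed.

End Reduction.

(** Common outcome of the abelian and the nonabelian case: for prime p, [z] is central of order p,
    and the loop modulo the powers of [z] is an elementary abelian p-group. *)
Record setup (M : magma) (p : nat) (z : mcar M) : Prop := Setup {
  s_center : z \in center M;
  s_neq1 : z <> mone M;
  s_ord : pow z p = mone M;
  s_comm : forall x y : mcar M, exists n, x ** y = (y ** x) ** pow z n;
  s_assoc : forall x y w : mcar M, exists n, (x ** y) ** w = (x ** (y ** w)) ** pow z n;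
  s_pow : forall x : mcar M, exists n, pow x p = pow z n }.

(** * Order p^3: cyclic, or elementary abelian modulo a central subgroup of order p *)

Section Trichotomy.
Variables (M : magma) (p : nat).
Hypotheses (loopM : is_loop M) (bolM : right_bol M) (pp : prime p).
Hypothesis cardM : #|mcar M| = p ^ 3.
Local Notation T := (mcar M).
Local Notation e := (mone M).
Implicit Types x y z w : T.

Lemma nonabelian_setup : centrally_nilpotent M -> center M <> [set: T] ->
  exists z : T, setup p z.
Proof.
move=> cnM ZT; have Zgt1 := cn_center_gt1 loopM pp (isT : 0 < 3) cardM cnM.
have [m m3 Em] := card_center loopM pp cardM.
have cQ := card_quot_center loopM pp cardM m3 Em.
(* Order 1 is excluded by nilpotency; orders p^2 and p^3 would make the center everything. *)
have m1 : m = 1.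
  case: m m3 Em cQ Zgt1 => [|[|[|[|]]]] // m3 Em cQ; rewrite ?Em // => _.
    by case: ZT; apply: (center_quot_prime loopM bolM pp cQ).
  by case: ZT; apply/eqP; rewrite eqEcard subsetT cardsT Em cardM leqnn.
rewrite m1 in Em cQ; rewrite /= in cQ.
have qL := quot_loop loopM; have qB := quot_bol loopM bolM.
have cnQ : centrally_nilpotent (quot (center M)).
  case: cnM loopM cardM qL cQ => [N cN _ cN'|//].
  by have := ltn_exp2r 1 p (isT : 0 < 3); rewrite exp1n -cN' cN (prime_gt1 pp).
have QT := cn_card_p2 qL qB pp cQ cnQ.
have [z zC z1] : exists2 z, z \in center M & z <> e.
  case/card_gt1P: Zgt1 => [x [y [xC yC xy]]].
  have [x1|/eqP] := eqVneq x e; last by exists x.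
  by exists y => // y1; move: xy; rewrite x1 y1 eqxx.
have zord : ord z = p.
  have [le _] := ord_sub (fun i => center_pow loopM i zC).
  have [[|[|n]] n3 En] := prime_pow_ord loopM bolM z pp cardM => //.
    by case: z1; apply: ord_eq1.
  move: le; rewrite Em En leq_exp2l ?prime_gt1 //.
have zgen w : w \in center M -> exists n, w = pow z n.
  have [_ H] := ord_sub (fun i => center_pow loopM i zC).
  by apply: H; rewrite zord Em expn1.
have qAb (A : mcar (quot (center M))) : A \in center (quot (center M)) by rewrite QT inE.
exists z; split=> //; first by rewrite -zord pow_ord.
- move=> x y; have := ctrC (qelt (center M) y : mcar (quot (center M))) (qAb (qelt (center M) x)).
  rewrite !qeltM // => /esym/eqP/(qeltP loopM)[w wC E].
  by have [n En] := zgen w wC; exists n; rewrite E En.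
- move=> x y w; have := ctrA (qelt (center M) x : mcar (quot (center M))) (qelt (center M) y)
    (qAb (qelt (center M) w)).
  rewrite !qeltM // => /eqP/(qeltP loopM)[v vC E].
  by have [n En] := zgen v vC; exists n; rewrite E En.
move=> x; suff : pow x p \in center M by apply: zgen.
pose A : mcar (quot (center M)) := qelt (center M) x.
(* The quotient has order p^2 and is not cyclic, since otherwise the center would be everything; so
   its elements have order 1 or p. *)
have pA : pow A p = mone _.
  have [n n2 En] := prime_pow_ord qL qB A pp cQ.
  case: n n2 En => [|[|[|]]] // _ En.
  - by rewrite (ord_eq1 qL En) pow_e.
  - by rewrite -[p in pow A p]expn1 -En pow_ord.
  by case: ZT; apply: (@center_quot_cyclic _ loopM bolM A); apply: pow_onto => //; rewrite En cQ.
move/esym/eqP: pA; rewrite (qelt_pow loopM) => /(qeltP loopM)[w wC ->].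
by rewrite mul1.
Qed.

(** The exponent divides p^2. If it divides p, any nonidentity [z] works; otherwise [z] is a^p for
    some a of order p^2, and every p-th power has to be shown to lie among the powers of a^p. *)
Lemma abelian_setup : center M = [set: T] -> (forall x, ord x <> p ^ 3) ->
  exists z : T, setup p z.
Proof.
move=> ZT ncyc; have inZ x : x \in center M by rewrite ZT inE.
have mC x y : x ** y = y ** x by apply: ctrC.
have mA x y w : (x ** y) ** w = x ** (y ** w) by rewrite ctrA.
suff [z [z1 zp zP]] : exists z : T, [/\ z <> e, pow z p = e & forall x, exists n, pow x p = pow z n].
  exists z; split=> // [x y|x y w]; exists 0; first by rewrite mulx1 // mC.
  by rewrite mulx1.
have p2 x : pow x (p * p) = e.
  have [n n3 En] := prime_pow_ord loopM bolM x pp cardM.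
  have n2 : n <= 2.
    by move: n3; rewrite leq_eqVlt => /orP[/eqP n3|//]; case: (ncyc x); rewrite En n3.
  by rewrite mulnn -(subnKC n2) expnD -En -powM // pow_ord // pow_e.
have [/forallP ep|] := boolP [forall x : T, pow x p == e].
  have /card_gt1P[x [y [_ _ xy]]] : 1 < #|T|.
    by rewrite cardM -{1}(exp1n 3) ltn_exp2r // prime_gt1.
  have [z z1] : exists z, z <> e.
    have [x1|/eqP] := eqVneq x e; last by exists x.
    by exists y => y1; move: xy; rewrite x1 y1 eqxx.
  by exists z; split=> // [|w]; [apply/eqP|exists 0; apply/eqP].
rewrite negb_forall => /existsP[a /eqP ap].
have oa : ord a = p * p.
  have [n n3 En] := prime_pow_ord loopM bolM a pp cardM.
  have : ord a %| p ^ 2 by rewrite -mulnn; apply: pow_eq1.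
  rewrite En; case: n n3 En => [|[|[|n]]] // _ En; last by rewrite dvdn_Pexp2l ?prime_gt1.
    by case: ap; rewrite (ord_eq1 loopM En) pow_e.
  by case: ap; rewrite -[p in pow a p]expn1 -En pow_ord.
exists (pow a p); split=> // [|x]; first by rewrite powM.
(* Two of the p^3 + p^2 products x^i a^j with i <= p and j < p^2 coincide. *)
have [i [j [i0 ip E]]] : exists i j, [/\ 0 < i, i <= p & pow x i = pow a j].
  pose h (u : 'I_p.+1 * 'I_(p * p)) := pow x u.1 ** pow a u.2.
  have /injectivePn[[i j] [[i' j'] ne /= E]] : ~~ injectiveb h.
    apply/negP => /injectiveP hI; have := leq_card h hI.
    by rewrite card_prod !card_ord cardM mulSn expnS -mulnn -[X in _ <= X]add0n leq_add2r
      leqNgt muln_gt0 prime_gt0.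
  wlog le : i j i' j' ne E / i <= i'.
    move=> W; case: (leqP i i') => [|/ltnW] le; first exact: (W i j i' j').
    by apply: (W i' j' i j); rewrite // eq_sym.
  (* The exponent p^2 - k plays the role of -k. *)
  have invj (k : 'I_(p * p)) : pow a k ** pow a (p * p - k) = e.
    by rewrite powD // subnKC ?p2 // ltnW.
  exists (i' - i), (j + (p * p - j')).
  have E' : pow x (i' - i) = pow a (j + (p * p - j')).
    apply: (@loopI _ loopM (pow x i)); rewrite powD // subnKC //.
    rewrite -powD // -mA -[LHS](mulx1 loopM) -(invj j') -mA; congr (_ ** _).
    exact: esym E.
  split=> //; last by rewrite (leq_trans (leq_subr i i')) // -ltnS.
  rewrite subn_gt0 ltn_neqAle le andbT; apply/negP => /eqP ii.
  move: E; rewrite /h /= ii => /(loopI loopM) jj.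
  case/negP: ne; rewrite xpair_eqE -!val_eqE /= ii eqxx /=.
  by apply/eqP/(@pow_inj _ a); rewrite ?oa.
have [s Es] : exists s, pow x p = pow a s.
  have [ip'|ip'] := eqVneq i p; first by exists j; rewrite -ip'.
  (* For i < p the exponent i is invertible modulo p^2, so x itself is a power of [a]. *)
  have cop : coprime i p.
    by rewrite coprime_sym prime_coprime // gtnNdvd // ltn_neqAle ip'.
  have [u _] := Bezoutl (p * p) i0.
  have -> : gcdn i (p * p) = 1 by apply/eqP; rewrite -/(coprime _ _) coprimeMr cop.
  case/dvdnP => v Ev; exists (j * v * p).
  have : pow x (v * i) = pow x 1.
    by rewrite -Ev -powD // mulnC -powM // p2 pow_e // mulx1.
  by rewrite mulnC -powM // E powM // pow1 // => <-; rewrite powM.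
(* From x^(p^2) = 1 it follows that p^2 divides s p, hence p divides s and x^p is a power of a^p. *)
have : ord a %| s * p by apply: pow_eq1; rewrite // -powM // -Es powM.
rewrite oa dvdn_pmul2r ?prime_gt0 // => /dvdnP[n En].
by exists n; rewrite Es En mulnC powM.
Qed.

Lemma cyclic_or_setup : centrally_nilpotent M ->
  (exists a : T, ord a = p ^ 3) \/ exists z : T, setup p z.
Proof.
move=> cnM; have [/existsP[a /eqP]|] := boolP [exists a : T, ord a == p ^ 3].
  by left; exists a.
rewrite negb_exists => /forallP nc; right.
have [ZT|/eqP ZT] := eqVneq (center M) [set: T]; last exact: nonabelian_setup.
by apply: abelian_setup => // x; apply/eqP.
Qed.

End Trichotomy.

(** * The model loops and their presentation *)

Section Model.
Local Open Scope ring_scope.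
Variable p : nat.

(** The carry when adding residues modulo p: the 2-cocycle of the cyclic group of order p^2 as an
    extension of the one of order p. *)
Definition carry (i k : 'F_p) : nat := ((i : nat) + (k : nat)) %/ p.

(** The polynomial part is the exponent of [z] found in [mul_ab_ab]; the carry terms come from a^p =
    z^al and b^p = z^be. *)
Definition model_mul (lam om al be : 'F_p) (x y : 'F_p * 'F_p * 'F_p) : 'F_p * 'F_p * 'F_p :=
  let: (i, j, c) := x in let: (k, l, d) := y in
  (i + k, j + l,
   c + d + (om * j * k + lam * k * (2%:R * i * j + i * l + j * k))
   + (al * (carry i k)%:R + be * (carry j l)%:R)).

Definition model (lam om al be : 'F_p) : magma :=
  @Magma ('F_p * 'F_p * 'F_p)%type (model_mul lam om al be) (0, 0, 0).

End Model.

(** Exponents of the central element are taken in the field, so that identities between them are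
    settled by [ring] and [field]. *)
Definition zp (p : nat) (M : magma) (z : mcar M) (k : 'F_p) : mcar M := pow z k.

Section CentralPower.
Variables (p : nat) (M : magma) (z : mcar M).
Hypotheses (pp : prime p) (loopM : is_loop M) (bolM : right_bol M).
Hypotheses (zC : z \in center M) (z_p : pow z p = mone M).
Local Notation T := (mcar M).
Local Notation e := (mone M).
Local Notation "z ^^ k" := (@zp p M z k) (at level 30).
Implicit Types x y w : T.

Lemma zp_nat n : z ^^ (n%:R)%R = pow z n.
Proof.
rewrite /zp val_Fp_nat // {2}(divn_eq n p) -powD // mulnC -powM // z_p.
by rewrite pow_e // mul1.
Qed.

Lemma zpE (k : 'F_p) : ((k : nat)%:R = k)%R.
Proof. exact: natr_Zp. Qed.

Lemma zp_center k : z ^^ k \in center M.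
Proof. exact: center_pow. Qed.

Lemma zp0 : z ^^ 0%R = e. Proof. by []. Qed.

Lemma mul_zpD x k l : (x ** z ^^ k) ** z ^^ l = x ** z ^^ (k + l)%R.
Proof. by rewrite mul_powD // -{2}(zpE k) -{2}(zpE l) -natrD zp_nat. Qed.

Lemma mul_zpA x y k : x ** (y ** z ^^ k) = (x ** y) ** z ^^ k.
Proof. exact/ctrA/zp_center. Qed.

Lemma mul_zpM x y k : (x ** z ^^ k) ** y = (x ** y) ** z ^^ k.
Proof. exact/ctrM/zp_center. Qed.

Lemma mul_zpK x y k : x ** z ^^ k = y -> x = y ** z ^^ (- k)%R.
Proof. by move=> <-; rewrite mul_zpD subrr mulx1. Qed.

Lemma pow_zp k n : pow (z ^^ k) n = z ^^ (k * n%:R)%R.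
Proof. by rewrite powM // -{2}(zpE k) -natrM zp_nat. Qed.

Lemma pow_mul_zp x k n : pow (x ** z ^^ k) n = pow x n ** z ^^ (k * n%:R)%R.
Proof.
elim: n => [|n IH]; first by rewrite mulr0 zp0 mulx1.
by rewrite !powS IH !(mul_zpD, mul_zpA, mul_zpM) -natr1 mulrDr mulr1.
Qed.

Lemma zp_inj : z <> e -> injective (zp z : 'F_p -> T).
Proof.
move=> z1; have oz : ord z = p.
  have : ord z %| p by apply: pow_eq1.
  by move/primeP: pp => [_ /[apply]]/pred2P[/ord_eq1-/(_ loopM)|].
have lt (k : 'F_p) : k < ord z by rewrite oz -{2}(Fp_cast pp) ltn_ord.
by move=> k l /(pow_inj (lt k) (lt l)) E; apply: val_inj.
Qed.

End CentralPower.

(** * Recovering the multiplication from two right translations *)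

Section Presentation.
Variables (p : nat) (M : magma) (z a b : mcar M).
Hypotheses (pp : prime p) (podd : odd p) (loopM : is_loop M) (bolM : right_bol M).
Hypotheses (zC : z \in center M) (z_p : pow z p = mone M).
Hypothesis cardM : #|mcar M| = p ^ 3.
Local Notation T := (mcar M).
Local Notation e := (mone M).
Local Notation "z ^^ k" := (@zp p M z k) (at level 30).
Implicit Types x y w : T.
Local Open Scope ring_scope.
Variables (K : T -> 'F_p) (lam om al be : 'F_p).
Hypotheses (a_p : pow a p = z ^^ al) (b_p : pow b p = z ^^ be).
Hypothesis KE : forall x, (x ** a) ** b = ((x ** b) ** a) ** z ^^ K x.
Hypotheses (K1 : K e = - (om + lam)) (Ka : forall x, K (x ** a) = K x - 2%:R * lam)
  (Kb : forall x, K (x ** b) = K x).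
Hypothesis gen : forall x, exists i j n, x = (pow a i ** pow b j) ** pow z n.

Let zD := mul_zpD pp loopM bolM z_p.
Let zA x y k : x ** (y ** z ^^ k) = (x ** y) ** z ^^ k := mul_zpA loopM zC x y k.
Let zM x y k : (x ** z ^^ k) ** y = (x ** y) ** z ^^ k := mul_zpM loopM zC x y k.
Let zK := mul_zpK pp loopM bolM z_p.

Lemma K_pow_a i : K (pow a i) = - (om + lam) - 2%:R * lam * i%:R.
Proof.
elim: i => [|i IH]; first by rewrite K1 mulr0 subr0.
by rewrite powS Ka IH -natr1; ring.
Qed.

(** [K] is constant along b, so each of the j exchanges of a with a letter b contributes the same
    exponent. *)
Lemma mul_powb_a x j : K (x ** pow b j) = K x /\
  (x ** pow b j) ** a = ((x ** a) ** pow b j) ** z ^^ (- (j%:R * K x)).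
Proof.
elim: j => [|j [IH1 IH2]]; first by rewrite !mulx1 // mul0r oppr0 mulx1.
rewrite -!mul_powS // Kb IH1; split=> //.
have /esym/zK -> := KE (x ** pow b j); rewrite IH2 !(zD, zA, zM) IH1.
by congr (_ ** zp z _); rewrite -natr1; ring.
Qed.

Lemma mul_ab_a i j k : (pow a i ** pow b j) ** pow a k =
  (pow a (i + k) ** pow b j) ** z ^^ (j%:R * k%:R * (om + lam * (2%:R * i%:R + k%:R))).
Proof.
elim: k => [|k IH]; first by rewrite mulx1 // addn0 mulr0 mul0r zp0 mulx1.
rewrite -mul_powS // IH zM; have [_ ->] := mul_powb_a (pow a (i + k)) j.
rewrite -powS -addnS !(zD, zA, zM); congr (_ ** zp z _).
by rewrite K_pow_a natrD -natr1; ring.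
Qed.

(** The Bol identity turns right multiplication by (b^m a^k) b^m into three multiplications by
    powers of a or b, and this element equals a^k b^(2m) up to a power of [z]. *)
Lemma mul_ab_ab_even i j k m : (pow a i ** pow b j) ** (pow a k ** pow b (m + m)) =
  (pow a (i + k) ** pow b (j + (m + m))) **
  z ^^ (om * j%:R * k%:R + lam * k%:R *
        (2%:R * i%:R * j%:R + i%:R * (m + m)%:R + j%:R * k%:R)).
Proof.
have E : (pow b m ** pow a k) ** pow b m =
    (pow a k ** pow b (m + m)) ** z ^^ (m%:R * k%:R * (om + lam * k%:R)).
  have := mul_ab_a 0 m k; rewrite pow0 mul1 // add0n mulr0 add0r => ->.
  by rewrite zM mul_powD.
have /esym := bolM (pow a i ** pow b j) (pow b m) (pow a k); rewrite E.
rewrite mul_powD // mul_ab_a zM mul_powD // -addnA zA => /zK ->.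
by rewrite zD; congr (_ ** zp z _); rewrite !natrD; ring.
Qed.

(** For odd l the even case is applied to l + p, which is even because p is odd. The extra b^p is
    central and cancels, and l + p equals l in the field. *)
Lemma mul_ab_ab i j k l : (pow a i ** pow b j) ** (pow a k ** pow b l) =
  (pow a (i + k) ** pow b (j + l)) **
  z ^^ (om * j%:R * k%:R + lam * k%:R *
        (2%:R * i%:R * j%:R + i%:R * l%:R + j%:R * k%:R)).
Proof.
have [lodd|leven] := boolP (odd l); last first.
  have lE : (l = l./2 + l./2)%N by rewrite addnn -[LHS]odd_double_half (negbTE leven).
  by rewrite lE mul_ab_ab_even.
have lE : (l + p = (l + p)./2 + (l + p)./2)%N.
  by rewrite addnn -[LHS]odd_double_half oddD lodd podd.
have := mul_ab_ab_even i j k (l + p)./2; rewrite -lE.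
have pE x n : x ** pow b (n + p)%N = (x ** pow b n) ** z ^^ be.
  by rewrite -mul_powD // b_p.
rewrite addnA !pE !zA natrD (pchar_Fp_0 pp) addr0 [RHS]zM.
exact: (loopIr loopM).
Qed.

Lemma pow_carry x t i k : pow x p = z ^^ t ->
  pow x ((i : 'F_p) + (k : 'F_p))%N = pow x (i + k)%R ** z ^^ (t * (carry i k)%:R).
Proof.
move=> xp; have vE : (i + k : 'F_p) = (((i : nat) + (k : nat)) %% p)%N :> nat.
  by rewrite -val_Fp_nat // natrD !zpE.
by rewrite vE {1}(divn_eq (i + k) p) -/(carry i k) addnC -powD // mulnC -powM // xp pow_zp.
Qed.

Theorem presentation_iso : isomorphic M (model lam om al be).
Proof.
apply: iso_sym; pose g (x : 'F_p * 'F_p * 'F_p) : T :=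
  (pow a x.1.1 ** pow b x.1.2) ** z ^^ x.2.
have gsurj x : exists u, g u == x.
  have pmod y t n : pow y p = z ^^ t ->
      pow y n = pow y (n%:R : 'F_p) ** z ^^ (t * (n %/ p)%:R).
    move=> yp; rewrite val_Fp_nat // {1}(divn_eq n p) addnC -powD // mulnC -powM //.
    by rewrite yp pow_zp.
  have [i [j [n ->]]] := gen x.
  rewrite -[pow z n](zp_nat pp loopM bolM z_p) (pmod a al i) // (pmod b be j) // !(zD, zA, zM).
  by eexists (_, _, _); apply/eqP.
have cg : #|T| = #|{: 'F_p * 'F_p * 'F_p}|.
  by rewrite !card_prod !card_Fp // cardM !expnSr expn0 mul1n.
(* A section [h] of [g] is injective between sets of equal size, hence bijective, and [g] is its
   inverse. *)
have gI : injective g.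
  pose h x := xchoose (gsurj x); have hK : cancel h g.
    by move=> x; apply/eqP/(xchooseP (gsurj x)).
  have /inj_card_bij [|f fK Kf] := can_inj hK; first by rewrite cg.
  have gE (w : 'F_p * 'F_p * 'F_p) : g w = f w by rewrite -{1}[w]Kf hK.
  by move=> u v; rewrite !gE => /(can_inj Kf).
exists g; split; first by apply: inj_card_bij; rewrite // cg.
case=> [[i j] c] [[k l] d]; rewrite /g /=.
rewrite -[RHS]/(_ ** _) zA zM zD mul_ab_ab !zD !zpE.
rewrite (pow_carry _ _ a_p) (pow_carry _ _ b_p) !(zD, zA, zM).
by congr (_ ** zp z _); ring.
Qed.

End Presentation.

(** * Affineness of the commutation defect *)

Lemma Fp_two_neq0 p : prime p -> odd p -> (2%:R != 0 :> 'F_p)%R.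
Proof.
move=> pp podd; rewrite -(dvdn_pcharf (pchar_Fp pp)) dvdn_prime2 //.
by case: eqP podd => // ->.
Qed.

Section SetupTheory.
Variables (p : nat) (M : magma) (z : mcar M).
Hypotheses (pp : prime p) (podd : odd p) (loopM : is_loop M) (bolM : right_bol M).
Hypothesis (S : setup p z).
Local Notation T := (mcar M).
Local Notation e := (mone M).
Local Notation "z ^^ k" := (@zp p M z k) (at level 30).
Implicit Types x y u v w : T.
Local Open Scope ring_scope.

Let zC := s_center S.
Let z_p := s_ord S.
Let zD := mul_zpD pp loopM bolM z_p.
Let zA x y k : x ** (y ** z ^^ k) = (x ** y) ** z ^^ k := mul_zpA loopM zC x y k.
Let zM x y k : (x ** z ^^ k) ** y = (x ** y) ** z ^^ k := mul_zpM loopM zC x y k.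
Let zK := mul_zpK pp loopM bolM z_p.
Let zn := zp_nat pp loopM bolM z_p.

Lemma mul_zp_inj x k l : x ** z ^^ k = x ** z ^^ l -> k = l.
Proof. by move/(loopI loopM)/(zp_inj pp loopM bolM z_p (s_neq1 S)). Qed.

(** Congruence modulo the powers of [z], used in place of a quotient loop. *)
Definition eqz x y := exists k, x = y ** z ^^ k.
Local Notation "x =z= y" := (eqz x y) (at level 70).

Lemma eqz_refl x : x =z= x. Proof. by exists 0; rewrite mulx1. Qed.
Lemma eqz_sym x y : x =z= y -> y =z= x.
Proof. by case=> k /esym/zK ->; exists (- k). Qed.
Lemma eqz_trans y x w : x =z= y -> y =z= w -> x =z= w.
Proof. by case=> k -> [l ->]; exists (l + k); rewrite zD. Qed.
Lemma eqz_mul x y u v : x =z= y -> u =z= v -> x ** u =z= y ** v.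
Proof. by case=> k -> [l ->]; exists (k + l); rewrite zM zA zM zD addrC. Qed.
Lemma eqz_mulr w x y : x =z= y -> x ** w =z= y ** w.
Proof. by move=> E; apply: eqz_mul (eqz_refl _). Qed.
Lemma eqz_mull w x y : x =z= y -> w ** x =z= w ** y.
Proof. exact: eqz_mul (eqz_refl _). Qed.
Lemma eqz_cancel w x y : x ** w =z= y ** w -> x =z= y.
Proof. by case=> k; rewrite -zM => /(loopIr loopM) ->; exists k. Qed.
Lemma eqz_comm x y : x ** y =z= y ** x.
Proof. by have [n ->] := s_comm S x y; exists n%:R; rewrite zn. Qed.
Lemma eqz_assoc x y w : (x ** y) ** w =z= x ** (y ** w).
Proof. by have [n ->] := s_assoc S x y w; exists n%:R; rewrite zn. Qed.
Lemma eqz_powp x : pow x p =z= e.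
Proof. by have [n ->] := s_pow S x; exists n%:R; rewrite zn mul1. Qed.
Lemma eqz_rcomm x u w : (x ** u) ** w =z= (x ** w) ** u.
Proof.
apply: eqz_trans (eqz_assoc _ _ _) _; apply: eqz_trans (eqz_mull _ (eqz_comm u w)) _.
exact/eqz_sym/eqz_assoc.
Qed.
Lemma eqz_pow x y n : x =z= y -> pow x n =z= pow y n.
Proof. by case=> k ->; rewrite (pow_mul_zp pp) //; exists (k * n%:R). Qed.
Lemma eqz_powpM x n : pow x (p * n) =z= e.
Proof. by rewrite -powM // -(pow_e loopM n); apply/eqz_pow/eqz_powp. Qed.
Lemma eqz_mul_powp y x n : y ** pow x (p * n) =z= y.
Proof. by rewrite -{2}[y](mulx1 loopM); apply/eqz_mull/eqz_powpM. Qed.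
Lemma eqz_powMn x y n : pow (x ** y) n =z= pow x n ** pow y n.
Proof.
elim: n => [|n IH]; first by rewrite mulx1 //; apply: eqz_refl.
rewrite powS -mul_powS // powS; apply: eqz_trans (eqz_mulr _ IH) _.
apply: eqz_trans (eqz_sym (eqz_assoc _ _ _)) _.
exact/eqz_mulr/eqz_rcomm.
Qed.

(** The commutation defect of R_u and R_w at [x]. The default 0 is never reached, since [eqz_rcomm]
    provides an exponent. *)
Definition Kf u w x : 'F_p :=
  odflt 0 [pick k : 'F_p | (x ** u) ** w == ((x ** w) ** u) ** z ^^ k].

Lemma KfP u w x : (x ** u) ** w = ((x ** w) ** u) ** z ^^ (Kf u w x).
Proof.
rewrite /Kf; case: pickP => [k /eqP //|H].
by have [k E] := eqz_rcomm x u w; have := H k; rewrite E eqxx.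
Qed.

Lemma Kf_eq u w x k : (x ** u) ** w = ((x ** w) ** u) ** z ^^ k -> Kf u w x = k.
Proof. by rewrite KfP => /mul_zp_inj. Qed.

Lemma Kf_eqz u w x y : x =z= y -> Kf u w x = Kf u w y.
Proof. by case=> k ->; apply: Kf_eq; rewrite !(zD, zA, zM) (KfP u w y) !zD addrC. Qed.

Lemma Kf_swap u w x : Kf w u x = - Kf u w x.
Proof. by apply: Kf_eq; apply: zK; rewrite -KfP. Qed.

(* R_w R_u^2 R_w and R_u R_w^2 R_u are right translations by elements that agree
   modulo z. *)
Lemma Kf_step u w : exists c, forall x, Kf u w ((x ** w) ** u) = Kf u w x + c.
Proof.
have ralt x y : x ** (y ** y) = (x ** y) ** y.
  by have := bolM x y e; rewrite !mulx1.
have [c cE] : (w ** (u ** u)) ** w =z= (u ** (w ** w)) ** u.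
  rewrite !ralt; apply: eqz_trans (eqz_rcomm _ _ _) _.
  exact/eqz_mulr/eqz_mulr/eqz_comm.
exists c => x; have := bolM x w (u ** u); rewrite cE zA -bolM !ralt.
rewrite (KfP u w ((x ** w) ** u)) (KfP u w x) !(zD, zA, zM) (KfP u w (x ** w)).
rewrite !(zD, zA, zM) => /mul_zp_inj/eqP; rewrite -subr_eq0 => /eqP E.
by apply/eqP; rewrite -subr_eq0; apply/eqP; rewrite -[RHS]E; ring.
Qed.

Lemma Kf_inv u v w y : (forall x, (x ** u) ** v = x) ->
  Kf v w (y ** u) = - Kf u w y.
Proof.
move=> uv; apply: Kf_eq; rewrite uv (KfP u w y) zM uv zD subrr mulx1 //.
Qed.

(** With v inverse to u, [Kf_step] for u and for v gives constant increments along R_w R_u and along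
    R_w R_v. Their composite is R_w^2 modulo [z], so the increment along R_w^2 is constant. *)
Lemma Kf_addr u w : exists d, forall y, Kf u w (y ** w) = Kf u w y + d.
Proof.
pose v := pow u (ord u).-1.
have uv x : (x ** u) ** v = x.
  by rewrite mul_powSr // prednK ?ord_gt0 // pow_ord // mulx1.
have vu x : (x ** v) ** u = x.
  by rewrite mul_powS // prednK ?ord_gt0 // pow_ord // mulx1.
have [c Hc] := Kf_step u w; have [c' Hc'] := Kf_step v w.
have Kv y : Kf u w ((y ** w) ** v) = Kf u w y - c'.
  have := Hc' (y ** u); rewrite (Kf_inv _ _ uv) -[_ ** v]vu (Kf_inv _ _ uv) => E.
  rewrite -[LHS]opprK; rewrite (_ : - Kf u w _ = - Kf u w y + c') ?opprD ?opprK //.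
  rewrite -E; congr (- _); apply: Kf_eqz; apply: eqz_mulr.
  by rewrite -{1}[y ** w]uv; apply/eqz_mulr/eqz_rcomm.
have K2 y : Kf u w ((y ** w) ** w) = Kf u w y + (c - c').
  rewrite addrA -Hc -Kv; apply: Kf_eqz.
  by rewrite -{1}[(y ** w) ** w]uv; apply/eqz_mulr/eqz_rcomm.
have K2n y n : Kf u w (y ** pow w n.*2) = Kf u w y + (c - c') *+ n.
  elim: n => [|n IH]; first by rewrite mulx1 // mulr0n addr0.
  by rewrite doubleS -!mul_powS // K2 IH mulrSr !addrA.
(* Since p is odd, w agrees modulo [z] with w^(p+1), which is (p+1)/2 double steps. *)
exists ((c - c') *+ uphalf p) => y; rewrite -K2n; apply: Kf_eqz; apply: eqz_sym.
rewrite -[y ** w]mulx1 //.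
have -> : (uphalf p).*2 = p.+1 by rewrite -[X in X.+1]odd_double_half podd uphalf_half podd doubleD.
by rewrite -mul_powSr // -{1}[p]muln1 mulx1 //; apply: eqz_mul_powp.
Qed.

Lemma Kf_addl u w : exists d, forall y, Kf u w (y ** u) = Kf u w y + d.
Proof.
have [d Hd] := Kf_addr w u; exists (- d) => y.
by rewrite -[LHS]opprK -Kf_swap Hd opprD -Kf_swap.
Qed.

(** * Two generators modulo the central subgroup, and the passage to a model *)

Definition generates a b := forall x, exists i j, x =z= pow a i ** pow b j.

(** The exponent m inverts d modulo p, and p-th powers vanish modulo [z]. *)
Lemma coprime_exp d : (0 < d < p)%N -> exists m : nat, forall x, pow x (d * m) =z= x.
Proof.
case/andP=> d0 dp; have [k _] := Bezoutl p d0.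
have -> : gcdn d p = 1%N.
  by apply/eqP; rewrite -/(coprime _ _) coprime_sym prime_coprime // gtnNdvd.
case/dvdnP=> m mE; exists m => x; rewrite mulnC -mE -powD // pow1 // mulnC.
exact: eqz_mul_powp.
Qed.

(** Take a outside the p powers of [z] and b outside the at most p^2 products a^i z^k. The p^3
    products a^i b^j z^k are then distinct and exhaust the loop. *)
Lemma generators : #|T| = (p ^ 3)%N -> exists a b, generates a b.
Proof.
move=> cM; have p1 := prime_gt1 pp.
have escape (I : finType) (f : I -> T) : (#|I| < p ^ 3)%N -> exists x, forall i, x <> f i.
  move=> lt; have [x /negP xA] : exists x, x \notin [set f i | i : I].
    apply/existsP; apply: contraLR lt; rewrite negb_exists -leqNgt => /forallP H.
    rewrite -cM (leq_trans _ (leq_imset_card f _)) //; apply/subset_leq_card/subsetP => x _.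
    by have := H x; rewrite negbK.
  by exists x => i E; apply: xA; rewrite E imset_f.
have [|a aN] := @escape 'F_p (zp z).
  by rewrite card_Fp // -{1}[p]expn1 ltn_exp2l.
have [|b bN] := @escape ('F_p * 'F_p)%type (fun q => pow a q.1 ** z ^^ q.2).
  by rewrite card_prod !card_Fp // mulnn ltn_exp2l.
have ltp (i : 'F_p) : (i < p)%N by rewrite -{2}(Fp_cast pp) ltn_ord.
have a0 d : (0 < d < p)%N -> ~ pow a d =z= e.
  move=> /coprime_exp[m /(_ a) mE] E; have : a =z= e.
    apply: eqz_trans (eqz_sym mE) _; rewrite -powM // -(pow_e loopM m).
    exact: eqz_pow.
  by case=> k; rewrite mul1 //; apply: aN.
have b0 d n : (0 < d < p)%N -> ~ pow b d =z= pow a n.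
  move=> /coprime_exp[m /(_ b) mE] E; have : b =z= pow a (n * m).
    apply: eqz_trans (eqz_sym mE) _; rewrite -powM // -powM //.
    exact: eqz_pow.
  case/eqz_trans/(_ (eqz_refl _)) => k bE.
  have [l lE] : pow a (n * m) =z= pow a ((n * m)%:R : 'F_p).
    rewrite val_Fp_nat // {1}(divn_eq (n * m) p) addnC -powD // (mulnC _ p).
    exact: eqz_mul_powp.
  by apply: (bN ((n * m)%:R, l + k)); rewrite bE lE /= zD.
pose h (u : 'F_p * 'F_p * 'F_p) := (pow a u.1.1 ** pow b u.1.2) ** z ^^ u.2.
have hI : injective h.
  case=> [[i j] k] [[i' j'] k']; rewrite /h /= => E.
  have E1 : pow a i ** pow b j =z= pow a i' ** pow b j'.
    by exists (k' - k); rewrite -zD -E zD subrr mulx1.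
  have jj : j = j' :> nat.
    wlog lt : i j k i' j' k' E E1 / (j <= j')%N.
      move=> W; case: (leqP j j') => [|/ltnW] le; first exact: (W i j k i' j' k').
      exact/esym/(W i' j' k' i j k)/le/eqz_sym.
    apply/eqP; rewrite eqn_leq lt leqNgt; apply/negP => ltj.
    have dlt : (0 < j' - j < p)%N by rewrite subn_gt0 ltj (leq_ltn_trans (leq_subr _ _)).
    (* Otherwise b^(j'-j) would be congruent to a^(i-i'); p - i' keeps the exponent a natural
       number. *)
    apply: (b0 _ (i + (p - i'))%N dlt).
    have E2 : pow a i =z= pow a i' ** pow b (j' - j).
      by apply: (@eqz_cancel (pow b j)); rewrite mul_powD // subnK.
    rewrite -powD //; apply: eqz_sym; apply: eqz_trans (eqz_mulr _ E2) _.
    apply: eqz_trans (eqz_mulr _ (eqz_comm _ _)) _.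
    rewrite mul_powD // subnKC ?(ltnW (ltp _)) //.
    by have := eqz_mul_powp (pow b (j' - j)) a 1; rewrite muln1.
  have {}jj : j = j' by apply: val_inj.
  subst j'; have E2 := eqz_cancel E1.
  have ii : i = i' :> nat.
    wlog lt : i k i' k' E E1 E2 / (i <= i')%N.
      move=> W; case: (leqP i i') => [|/ltnW] le; first exact: (W i k i' k').
      by apply/esym/(W i' k' i k) => //; apply: eqz_sym.
    apply/eqP; rewrite eqn_leq lt leqNgt; apply/negP => lti.
    apply: (a0 (i' - i)%N); first by rewrite subn_gt0 lti (leq_ltn_trans (leq_subr _ _)).
    by apply: (@eqz_cancel (pow a i)); rewrite powD // subnK // mul1 //; apply: eqz_sym.
  have {}ii : i = i' by apply: val_inj.
  by subst i'; move/mul_zp_inj: E => ->.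
have [|g gK Kg] := inj_card_bij hI; first by rewrite cM !card_prod !card_Fp // !expnSr expn0 mul1n.
exists a, b => x; exists (g x).1.1, (g x).1.2; rewrite -{1}[x]Kg.
by exists (g x).2.
Qed.

(** The parameters are solved from the presentation: d = -2 lam is the increment of [Kf] along a,
    and its value at 1 is -(om + lam). *)
Lemma basis_iso a b : #|T| = (p ^ 3)%N -> generates a b ->
  (forall y, Kf a b (y ** b) = Kf a b y) ->
  exists lam om al be : 'F_p, isomorphic M (model lam om al be).
Proof.
move=> cM gen Kb; have [d Hd] := Kf_addl a b.
have [n an] := s_pow S a; have [m bm] := s_pow S b.
have two := Fp_two_neq0 pp podd.
exists (- d / 2%:R), (d / 2%:R - Kf a b e), n%:R, m%:R.
apply: (@presentation_iso p M z a b pp podd loopM bolM zC z_p cM (Kf a b)) => //.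
- by rewrite zn.
- by rewrite zn.
- exact: KfP.
- by rewrite mulNr addrAC subrr add0r opprK.
- by move=> x; rewrite Hd; field.
by move=> x; have [i [j [k ->]]] := gen x; exists i, j, k.
Qed.

Lemma Kf_mul_pow a b d : (forall y, Kf a b (y ** b) = Kf a b y + d) ->
  forall y n, Kf a b (y ** pow b n) = Kf a b y + d *+ n.
Proof.
move=> Hd y; elim=> [|n IH]; first by rewrite mulx1 // addr0.
by rewrite -mul_powS // Hd IH mulrSr addrA.
Qed.

Lemma setup_model : #|T| = (p ^ 3)%N ->
  exists lam om al be : 'F_p, isomorphic M (model lam om al be).
Proof.
move=> cM; have [a [b gen]] := generators cM.
have [da Ha] := Kf_addl a b; have [db Hb] := Kf_addr a b.
have [db0|db0] := eqVneq db 0.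
  by apply: (basis_iso cM gen) => y; rewrite Hb db0 addr0.
have two := Fp_two_neq0 pp podd.
(* This solves da + 2 t db = 0, so the defect is constant along a', which takes the place of the
   second generator. *)
pose t : 'F_p := - da / (2%:R * db).
(* [a'] is [a * b^(2t)] modulo [z]; in this shape its right translation is R_b^t R_a R_b^t. *)
pose a' := (pow b t ** a) ** pow b t.
have Ra' x : x ** a' = ((x ** pow b t) ** a) ** pow b t by rewrite bolM.
have K' x : Kf a' b x = Kf a b (x ** pow b t).
  apply: Kf_eq; rewrite !Ra' mul_powS // -mul_powSr // (KfP a b (x ** pow b t)) zM.
  by rewrite mul_powSr // mul_powS.
apply: (@basis_iso b a' cM) => [x|y]; last first.
  rewrite Kf_swap [RHS]Kf_swap !K' Ra'; congr (- _).
  rewrite mul_powD // (Kf_mul_pow Hb) Ha -addrA -[RHS]addr0; congr (_ + _).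
  rewrite -mulr_natr natrD !zpE /t; field; exact/andP.
have [i [j ij]] := gen x.
(* A natural number representing -2t modulo p, used to write a through a' and b. *)
pose m := ((t + t) * p.-1)%N.
have aE : a' ** pow b m =z= a.
  have : a' =z= a ** pow b (t + t)%N.
    by rewrite -mul_powD //; apply/eqz_mulr/eqz_comm.
  move/(eqz_mulr (pow b m))/eqz_trans; apply.
  rewrite mul_powD // -mulnS prednK ?prime_gt0 // mulnC; exact: eqz_mul_powp.
exists (m * i + j)%N, i; apply: eqz_trans ij _; apply: eqz_trans _ (eqz_comm _ _).
rewrite -mul_powD // -powM //; apply: eqz_mulr; apply: eqz_trans (eqz_powMn _ _ _).
exact/eqz_pow/eqz_sym.
Qed.

End SetupTheory.

(** * Arithmetic of the model loops *)

Section ModelTheory.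
Variable p : nat.
Hypotheses (pp : prime p) (podd : odd p).
Local Notation F := 'F_p.
Local Open Scope ring_scope.
Implicit Types i j k l m : F.

Lemma val_FpD i k : (i + k : F) = (((i : nat) + (k : nat)) %% p)%N :> nat.
Proof. by rewrite -val_Fp_nat // natrD !zpE. Qed.

Lemma Fp_lt i : (i < p)%N. Proof. by rewrite -{2}(Fp_cast pp) ltn_ord. Qed.

Lemma carryE i k : ((i : nat) + k = carry i k * p + nat_of_ord (i + k)%R)%N.
Proof. by rewrite val_FpD -divn_eq. Qed.

Lemma carryC i k : carry i k = carry k i.
Proof. by rewrite /carry addnC. Qed.

Lemma carry0 i : carry i 0 = 0%N.
Proof. by rewrite /carry addn0 divn_small ?Fp_lt. Qed.

(** The cocycle identity: multiplied by p, each side is the integer i + k + m minus its residue. *)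
Lemma carryA i k m : (carry i k + carry (i + k)%R m = carry k m + carry i (k + m)%R)%N.
Proof.
apply/eqP; rewrite -(eqn_pmul2r (prime_gt0 pp)) !mulnDl; apply/eqP.
have := carryE i k; have := carryE (i + k) m; have := carryE k m.
have := carryE i (k + m); rewrite (addrA i).
move: (carry i k) (carry (i + k) m) (carry k m) (carry i (k + m)) => c1 c2 c3 c4.
move: (nat_of_ord i) (nat_of_ord k) (nat_of_ord m) => ni nk nm.
move: (nat_of_ord (i + k + m)) (nat_of_ord (k + m)) (nat_of_ord (i + k)) => n1 n2 n3.
move=> E1 E2 E3 E4; apply: (@addIn n1).
by rewrite -!addnA -E3 -E1 (addnCA (c3 * p)%N) -E2 (addnA (c1 * p)%N) -E4 addnA.
Qed.

Definition cr i k : F := (carry i k)%:R.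

Lemma crC i k : cr i k = cr k i. Proof. by rewrite /cr carryC. Qed.
Lemma cr0 i : cr i 0 = 0. Proof. by rewrite /cr carry0. Qed.
Lemma cr0l i : cr 0 i = 0. Proof. by rewrite crC cr0. Qed.
Lemma crA i k m : cr i k + cr (i + k) m = cr k m + cr i (k + m).
Proof. by rewrite /cr -!natrD carryA. Qed.

Lemma triple_inj (i j k i' j' k' : F) : (i, j, k) = (i', j', k') -> [/\ i = i', j = j' & k = k'].
Proof. by move=> E; split; [have := congr1 (fst \o fst) E | have := congr1 (snd \o fst) E | have := congr1 snd E]. Qed.

Section Params.
Variables lam om al be : F.
Local Notation Q := (model lam om al be).
Local Notation elt := (fun i j c : F => ((i, j, c) : mcar Q)).

Lemma modelE i j (c : F) k l (d : F) : elt i j c ** elt k l d =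
  elt (i + k) (j + l) (c + d + (om * j * k + lam * k * (2%:R * i * j + i * l + j * k))
   + (al * cr i k + be * cr j l)).
Proof. by []. Qed.

Lemma model_loop : is_loop Q.
Proof.
split; last split.
- move=> [[i j] c]; rewrite -[mone _]/(elt 0 0 0) !modelE !cr0 !cr0l.
  by split; congr (_, _, _); ring.
- move=> [[i j] c]; apply: injF_bij => -[[k l] d] [[k' l'] d'].
  by rewrite !modelE => /triple_inj[/addrI-> /addrI-> /addIr/addIr/addrI ->].
- move=> [[i j] c]; apply: injF_bij => -[[k l] d] [[k' l'] d'].
  by rewrite !modelE => /triple_inj[/addIr-> /addIr-> /addIr/addIr/addIr ->].
Qed.

Lemma model_bol : right_bol Q.
Proof.
move=> [[i j] c] [[k l] d] [[m n] f]; rewrite !modelE.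
(* The carry terms satisfy the Bol identity because they form a cocycle; the polynomial terms are
   left to [ring]. *)
have bol x y z : cr x y + cr (x + y) z + cr (x + y + z) y =
    cr y z + cr (y + z) y + cr x (y + z + y).
  by rewrite (crA x y z) -addrA -[x + y + z]addrA (crA x (y + z) y) addrA.
congr (_, _, _); rewrite ?addrA //; apply/eqP; rewrite -subr_eq0; apply/eqP.
transitivity (al * ((cr i k + cr (i + k) m + cr (i + k + m) k) -
    (cr k m + cr (k + m) k + cr i (k + m + k))) +
  be * ((cr j l + cr (j + l) n + cr (j + l + n) l) -
    (cr l n + cr (l + n) l + cr j (l + n + l)))); first by ring.
by rewrite !bol !subrr !mulr0 addr0.
Qed.

Lemma card_model : #|mcar Q| = (p ^ 3)%N.
Proof. by rewrite !card_prod !card_Fp // !expnSr expn0 mul1n. Qed.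

Lemma model_mulz x (t : F) : x ** elt 0 0 t = elt x.1.1 x.1.2 (x.2 + t).
Proof.
case: x => [[i j] c]; rewrite !modelE !cr0 /=.
by congr (_, _, _); ring.
Qed.

Lemma model_zmul x (t : F) : elt 0 0 t ** x = elt x.1.1 x.1.2 (x.2 + t).
Proof.
case: x => [[i j] c]; rewrite !modelE !cr0l /=.
by congr (_, _, _); ring.
Qed.

Lemma model_zC (t : F) : elt 0 0 t \in center Q.
Proof.
apply/centerP => -[[i j] c] [[k l] d]; split; rewrite ?model_mulz ?model_zmul //=.
all: by rewrite ?modelE; congr (_, _, _) => /=; ring.
Qed.

Lemma model_K i j c k l d m n f :
  (elt i j c ** elt k l d) ** elt m n f = ((elt i j c ** elt m n f) ** elt k l d) **
    elt 0 0 (- (k * n - l * m) * (om + lam * (2%:R * i + k + m))).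
Proof.
rewrite model_mulz !modelE /=.
have com x y z : cr x y + cr (x + y) z = cr x z + cr (x + z) y.
  by rewrite !crA (crC y) (addrC y).
congr (_, _, _); rewrite 1?addrAC //; apply/eqP; rewrite -subr_eq0; apply/eqP.
transitivity (al * ((cr i k + cr (i + k) m) - (cr i m + cr (i + m) k)) +
  be * ((cr j l + cr (j + l) n) - (cr j n + cr (j + n) l))); first by ring.
by rewrite (com i) (com j) !subrr !mulr0 addr0.
Qed.

Lemma model_A i j c k l d m n f :
  (elt i j c ** elt k l d) ** elt m n f = (elt i j c ** (elt k l d ** elt m n f)) **
    elt 0 0 (- lam * i * (k * n - l * m)).
Proof.
rewrite model_mulz !modelE /=.
congr (_, _, _); rewrite ?addrA //; apply/eqP; rewrite -subr_eq0; apply/eqP.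
transitivity (al * ((cr i k + cr (i + k) m) - (cr k m + cr i (k + m))) +
  be * ((cr j l + cr (j + l) n) - (cr l n + cr j (l + n)))); first by ring.
by rewrite !crA !subrr !mulr0 addr0.
Qed.

Lemma model_C k l d m n f : elt k l d ** elt m n f = (elt m n f ** elt k l d) **
  elt 0 0 (- (k * n - l * m) * (om + lam * (k + m))).
Proof.
have := model_K 0 0 0 k l d m n f.
by rewrite -[elt 0 0 0]/(mone Q) !(mul1 model_loop) mulr0 add0r.
Qed.

Lemma model_cn : centrally_nilpotent Q.
Proof.
apply: cn_class2; first exact: model_loop.
  move=> [[k l] d] [[m n] f]; rewrite model_C; eexists; last by [].
  exact: model_zC.
move=> [[i j] c] [[k l] d] [[m n] f]; rewrite model_A; eexists; last by [].
exact: model_zC.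
Qed.

(** The coefficients sum the increments over t < n: the sum of t is C(n,2), the sum of 2t(t+1) is 4
    C(n+1,3), and the carries add up to integer quotients. *)
Lemma model_pow i j c n : pow (elt i j c) n = elt (i * n%:R) (j * n%:R)
  (c * n%:R + om * i * j * 'C(n, 2)%:R + lam * i ^+ 2 * j * (4 * 'C(n.+1, 3))%:R
   + (al * ((n * i) %/ p)%N%:R + be * ((n * j) %/ p)%N%:R)).
Proof.
elim: n => [|n IH].
  by rewrite !mul0n !div0n !mulr0 !addr0.
have crS k : ((n.+1 * k) %/ p)%N%:R = ((n * k) %/ p)%N%:R + cr (k * n%:R) k.
  rewrite /cr /carry -natrD; congr (_%:R).
  have -> : (k * n%:R : F) = ((n * k) %% p)%N :> nat.
    by rewrite -val_Fp_nat // natrM zpE mulrC.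
  by rewrite mulSnr {1}(divn_eq (n * k) p) -addnA divnMDl ?prime_gt0.
rewrite powS IH modelE !crS.
have -> : (4 * 'C(n.+2, 3))%:R = (4 * 'C(n.+1, 3))%:R + 2%:R * (n%:R + 1) * n%:R :> F.
  rewrite binS mulnDr natrD; congr (_ + _).
  have E : ('C(n.+1, 2) * 2 = n.+1 * n)%N by have := bin_ffact n.+1 2; rewrite !ffactnS ffactn0 muln1.
  have -> : (4 * 'C(n.+1, 2) = 2 * (n.+1 * n))%N by rewrite -E mulnCA mulnC.
  by rewrite !natrM -[n.+1%:R]natr1 mulrA.
have -> : 'C(n.+1, 2)%:R = 'C(n, 2)%:R + n%:R :> F by rewrite binS bin1 natrD.
by rewrite -!natr1; congr (_, _, _); ring.
Qed.

(** The coefficient of lam i^2 j in a p-th power. Six times it is 4(p+1)p(p-1), which is 0 in the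
    field, so for odd p it vanishes unless p = 3. *)
Definition eps : F := (4 * 'C(p.+1, 3))%:R.

Lemma model_powp i j c :
  pow (elt i j c) p = elt 0 0 (al * i + be * j + eps * lam * i ^+ 2 * j).
Proof.
have C0 : 'C(p, 2)%:R = 0 :> F.
  apply/eqP; rewrite -(dvdn_pcharf (pchar_Fp pp)) prime_dvd_bin //=.
  by case: p pp podd => [|[|[|]]].
rewrite model_pow (pchar_Fp_0 pp) !mulr0 C0 mulr0 -/eps !mulKn ?prime_gt0 // !zpE.
by congr (_, _, _); ring.
Qed.

End Params.
End ModelTheory.

(** * Isomorphisms between model loops *)

Lemma mul_fix (M : magma) (x t : mcar M) : is_loop M -> x = x ** t -> t = mone M.
Proof. by move=> loopM E; apply: (loopI loopM (a := x)); rewrite -E mulx1. Qed.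

Section Homomorphism.
Variables (M M' : magma) (f : mcar M -> mcar M').
Hypotheses (loopM : is_loop M) (loopM' : is_loop M').
Hypothesis fM : forall x y, f (x ** y) = f x ** f y.

Lemma hom1 : f (mone M) = mone M'.
Proof. by apply: (loopI loopM' (a := f (mone M))); rewrite -fM !mulx1. Qed.

Lemma hom_pow x n : f (pow x n) = pow (f x) n.
Proof. by elim: n => [|n IH]; [exact: hom1 | rewrite !powS fM IH]. Qed.

End Homomorphism.

Section Classification.
Variable p : nat.
Hypotheses (pp : prime p) (podd : odd p).
Local Notation F := 'F_p.
Local Open Scope ring_scope.
Local Notation two := (Fp_two_neq0 pp podd).

(** Either [eps] is 0, or p = 3 and every nonzero square is 1. *)
Lemma eps_sq (k : F) : k != 0 -> eps p * k ^+ 2 = eps p.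
Proof.
move=> k0; have [->|e0] := eqVneq (eps p) 0; first by rewrite mul0r.
have : eps p * (2%:R * 3%:R) = 0.
  rewrite -!natrM -mulnA -[(2 * 3)%N]/(3`!) bin_ffact !ffactnS ffactn0 /=.
  by rewrite !natrM (pchar_Fp_0 pp) mul0r !mulr0.
move/eqP; rewrite !mulf_eq0 (negbTE e0) (negbTE two) /= -(dvdn_pcharf (pchar_Fp pp)).
rewrite dvdn_prime2 // => /eqP p3; rewrite -[RHS]mulr1; congr (_ * _).
have three : 3%:R = 0 :> F by rewrite -p3 (pchar_Fp_0 pp).
have lt : (k < 3)%N by rewrite -p3 (Fp_lt pp).
move: k0; rewrite -(zpE k); case: (nat_of_ord k) lt => [|[|[|]]] //; first by rewrite expr1n.
by rewrite -natrX -[(2 ^ 2)%N]/(3 + 1)%N natrD three add0r.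
Qed.

(** A generator of the cyclic unit group serves. Were it a square, squaring would be onto and hence
    injective, against 1 = (-1)^2; the parity of the exponent separates the two classes. *)
Lemma nonsquare : exists nu : F, (forall h, h ^+ 2 <> nu) /\
  forall g, g != 0 -> exists2 h, h != 0 & g = h ^+ 2 \/ g = nu * h ^+ 2.
Proof.
have /cyclicP[u uE] := field_unit_group_cyclic [set: {unit F}]%G.
have gen (g : F) : g != 0 -> exists n, g = val u ^+ n.
  rewrite -unitfE => gU; have : FinRing.Unit gU \in <[u]>%g by rewrite -uE inE.
  by case/cycleP=> n /(congr1 val); rewrite FinRing.val_unitX /= => ->; exists n.
have u0 : val u != 0 by rewrite -unitfE; case: (u).
exists (val u); split=> [h hE|g /gen[n ->]].
  have /imset_injP sqI : #|(fun x : F => x ^+ 2) @: [set: F]| == #|[set: F]|.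
    apply/eqP/eq_card => g; rewrite inE; apply/imsetP.
    have [->|/gen[n ->]] := eqVneq g 0; first by exists 0; rewrite ?inE ?expr0n.
    by exists (h ^+ n); rewrite ?inE // exprAC hE.
  have : 1 = -1 :> F by apply: sqI; rewrite ?inE // sqrrN.
  by move/eqP; rewrite -addr_eq0 -mulr2n (negbTE two).
exists (val u ^+ n./2); first exact: expf_neq0.
rewrite -exprM muln2 -{1 3}(odd_double_half n) exprD.
by case: (odd n); [right|left; rewrite mul1r].
Qed.

(** * Change of generators and invariants of a model *)

Section Change.
Variables lam om al be : F.
Local Notation Q := (model lam om al be).
Local Notation elt := (fun i j c : F => ((i, j, c) : mcar Q)).

Lemma model_zpow c n : pow (elt 0 0 c) n = elt 0 0 (c * n%:R).
Proof.
rewrite model_pow // !muln0 !div0n !mul0r !mulr0 mul0r !addr0.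
by congr (_, _, _); ring.
Qed.

Lemma model_zp c (t : F) : zp (elt 0 0 c) t = elt 0 0 (c * t).
Proof. by rewrite /zp model_zpow zpE. Qed.

(** The presentation theorem is applied to the model itself with new generators (k,s,0), (r,d,0) and
    (0,0,c). The condition on r keeps the defect constant along the new second generator. *)
Lemma model_change (k s r d c : F) : k * d - s * r != 0 -> c != 0 -> lam * r = 0 ->
  isomorphic Q (model ((k * d - s * r) * k * lam / c) ((k * d - s * r) * om / c)
    ((al * k + be * s + eps p * lam * k ^+ 2 * s) / c) ((al * r + be * d) / c)).
Proof.
move=> D0 c0 lr; pose K (x : F * F * F) := - (k * d - s * r) * (om + lam * (2%:R * x.1.1 + k)) / c.
have zp1 : pow (elt 0 0 c) p = mone Q by rewrite model_zpow (pchar_Fp_0 pp) mulr0.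
apply: (@presentation_iso p Q (elt 0 0 c) (elt k s 0) (elt r d 0) pp podd
  (model_loop pp _ _ _ _) (@model_bol p pp lam om al be) (model_zC pp _ _ _ _ _) zp1 (card_model pp _ _ _ _) K).
- by rewrite model_powp // model_zp [c * _]mulrC divfK.
- rewrite model_powp // model_zp [c * _]mulrC divfK //; congr (_, _, _).
  rewrite (_ : _ * _ * d = eps p * (lam * r) * r * d); last by ring.
  by rewrite lr; ring.
- move=> [[i j] t]; rewrite model_K // model_zp; congr (_ ** _); congr (_, _, _).
  rewrite /K /= [RHS]mulrC divfK //; congr (_ * _).
  by rewrite [in LHS]mulrDr lr addr0.
- by rewrite /K /=; ring.
- by move=> [[i j] t]; rewrite modelE /K /=; ring.
- move=> [[i j] t]; rewrite modelE /K /= [2%:R * (i + r)]mulrDr.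
  rewrite (_ : lam * (_ + _) = lam * (2%:R * i + k) + 2%:R * (lam * r)); last by ring.
  by rewrite lr mulr0 addr0.
move=> [[x1 x2] x3].
(* Cramer's rule for the first two coordinates; the third is then corrected by a power of the
   central generator. *)
pose i := (x1 * d - x2 * r) / (k * d - s * r); pose j := (k * x2 - s * x1) / (k * d - s * r).
have [w wE] : exists w, pow (elt k s 0) i ** pow (elt r d 0) j = elt x1 x2 w.
  have e1 : k * i + r * j = x1.
    rewrite /i /j !mulrA -mulrDl; apply: canLR (mulfK D0) _; ring.
  have e2 : s * i + d * j = x2.
    rewrite /i /j !mulrA -mulrDl; apply: canLR (mulfK D0) _; ring.
  by rewrite !model_pow // modelE !zpE e1 e2; eexists.
exists i, j, ((x3 - w) / c : F); rewrite wE model_zpow model_mulz // zpE /=.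
by rewrite mulrC divfK // addrC subrK.
Qed.

(** Right translation by a central element commutes with all others, so the exponent in [model_K]
    vanishes at every x; a suitable x makes its second factor nonzero. *)
Lemma model_center i j c : (lam != 0) || (om != 0) -> elt i j c \in center Q -> i = 0 /\ j = 0.
Proof.
move=> nc yC; have loopQ := model_loop pp lam om al be.
have H m n : i * n - j * m = 0.
  have [x x0] : exists x, om + lam * (2%:R * x + i + m) != 0.
    have [l0|l0] := eqVneq lam 0; first by exists 0; rewrite l0 mul0r addr0; move: nc; rewrite l0 eqxx.
    (* With this x the factor equals [lam]. *)
    exists ((1 - om / lam - i - m) / 2%:R); rewrite [2%:R * _]mulrC divfK ?two //.
    rewrite (_ : om + _ = lam + (om - om / lam * lam)); last by ring.
    by rewrite divfK // subrr addr0.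
  have := model_K pp lam om al be x 0 0 i j c m n 0; rewrite (ctrM _ _ yC) => /(mul_fix loopQ)/triple_inj[_ _ /eqP].
  by rewrite mulf_eq0 (negbTE x0) orbF oppr_eq0 => /eqP.
split; first by have := H 0 1; rewrite mulr1 mulr0 subr0.
by have := H 1 0; rewrite mulr1 mulr0 sub0r => /eqP; rewrite oppr_eq0 => /eqP.
Qed.

Lemma model_commP : (forall x y : mcar Q, x ** y = y ** x) -> lam = 0 /\ om = 0.
Proof.
move=> C; have loopQ := model_loop pp lam om al be.
have H k : - k * (om + lam * k) = 0.
  have := model_C pp lam om al be k 0 0 0 1 0; rewrite C => /(mul_fix loopQ)/triple_inj[_ _].
  by rewrite mulr1 mul0r subr0 addr0.
have := H 1; have := H (-1); rewrite opprK mul1r mulr1 mulN1r mulrN1 => /eqP.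
rewrite subr_eq0 => /eqP -> /eqP; rewrite oppr_eq0 -mulr2n -mulr_natl mulf_eq0 (negbTE two).
by move/eqP.
Qed.

Lemma model_comm0 : lam = 0 -> om = 0 -> forall x y : mcar Q, x ** y = y ** x.
Proof.
move=> l0 o0 [[k l] d] [[m n] f]; rewrite model_C //.
have -> : om + lam * (k + m) = 0 by rewrite l0 o0 mul0r addr0.
by rewrite mulr0 (mulx1 (model_loop pp lam om al be)).
Qed.

End Change.

(** Centers correspond, so (0,0,1) maps to (0,0,c). Here y and w are the images of the two
    generators modulo the center; defects and p-th powers are compared on both sides. *)
Lemma model_iso_inv lam om al be lam' om' al' be' :
  (lam != 0) || (om != 0) -> (lam' != 0) || (om' != 0) ->
  isomorphic (model lam om al be) (model lam' om' al' be') ->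
  exists (y1 y2 w1 w2 c : F), [/\ c != 0, y1 * w2 - y2 * w1 != 0 &
    [/\ lam' * w1 = 0, (y1 * w2 - y2 * w1) * lam' * y1 = c * lam,
        (y1 * w2 - y2 * w1) * om' = c * om,
        al' * y1 + be' * y2 + eps p * lam' * y1 ^+ 2 * y2 = c * al &
        al' * w1 + be' * w2 + eps p * lam' * w1 ^+ 2 * w2 = c * be]].
Proof.
move=> nc nc' [f [bf fM]].
have loopQ := model_loop pp lam om al be; have loopQ' := model_loop pp lam' om' al' be'.
set Q := model lam om al be; set Q' := model lam' om' al' be'.
pose E (i j c : F) : mcar Q := (i, j, c); pose E' (i j c : F) : mcar Q' := (i, j, c).
have [c zE] : exists c, f (E 0 0 1) = E' 0 0 c.
  have : f (E 0 0 1) \in center Q' by rewrite -(iso_center bf fM) model_zC.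
  by case: (f _) => [[i j] c] /(model_center nc') [-> ->]; exists c.
have zE' t : f (E 0 0 t) = E' 0 0 (c * t).
  have -> : E 0 0 t = pow (E 0 0 1) t by rewrite model_zpow zpE mul1r.
  by rewrite (hom_pow loopQ loopQ' fM) zE model_zpow zpE.
have c0 : c != 0.
  apply/eqP => c0; have : E 0 0 1 = E 0 0 0.
    by apply: (bij_inj bf); rewrite !zE' c0 !mul0r.
  by case/triple_inj => _ _ /eqP; rewrite oner_eq0.
case aE : (f (E 1 0 0)) => [[y1 y2] y3]; case bE : (f (E 0 1 0)) => [[w1 w2] w3].
have KE i j : (y1 * w2 - y2 * w1) * (om' + lam' * (2%:R * (f (E i j 0)).1.1 + y1 + w1)) =
    c * (om + lam * (2%:R * i + 1)).
  have := congr1 f (model_K pp lam om al be i j 0 1 0 0 0 1 0).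
  rewrite !fM zE' -/(E _ _ _) aE bE; case: (f _) => [[x1 x2] x3].
  rewrite (model_K pp lam' om' al' be' x1 x2 x3 y1 y2 y3 w1 w2 w3) => /(loopI loopQ')/triple_inj[_ _ /eqP].
  by rewrite !mulr1 mul0r subr0 addr0 !mulNr mul1r mulrN eqr_opp => /eqP /=.
have PE i j : forall x1 x2 x3, f (E i j 0) = E' x1 x2 x3 ->
  al' * x1 + be' * x2 + eps p * lam' * x1 ^+ 2 * x2 =
  c * (al * i + be * j + eps p * lam * i ^+ 2 * j).
  move=> x1 x2 x3 xE; have := congr1 f (model_powp pp podd lam om al be i j 0).
  by rewrite (hom_pow loopQ loopQ' fM) xE model_powp // zE' => /triple_inj[].
exists y1, y2, w1, w2, c; set D := y1 * w2 - y2 * w1 in KE *.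
(* Differences between these three instances isolate the coefficients of [lam] and [om]. *)
have K0 := KE 0 0; have Ka := KE 1 0; have Kb := KE 0 1.
rewrite aE /= in Ka; rewrite bE /= in Kb.
rewrite (hom1 loopQ loopQ' fM : f (E 0 0 0) = _) /= in K0.
have Ew : D * lam' * w1 = 0.
  apply: (mulfI two); rewrite mulr0 (_ : 2%:R * (D * _ * _) = D * (om' + lam' * (2%:R * w1 + y1 + w1)) -
    D * (om' + lam' * (2%:R * 0 + y1 + w1))); last by ring.
  by rewrite Kb K0; ring.
have Ey : D * lam' * y1 = c * lam.
  apply: (mulfI two); rewrite (_ : 2%:R * (D * _ * _) = D * (om' + lam' * (2%:R * y1 + y1 + w1)) -
    D * (om' + lam' * (2%:R * 0 + y1 + w1))); last by ring.
  by rewrite Ka K0; ring.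
have Eo : D * om' = c * om.
  rewrite (_ : D * om' = D * (om' + lam' * (2%:R * 0 + y1 + w1)) - D * lam' * y1 - D * lam' * w1);
    last by ring.
  by rewrite K0 Ey Ew; ring.
have D0 : D != 0.
  apply/eqP => D0; move: Ey Eo; rewrite D0 !mul0r => /esym/eqP + /esym/eqP.
  by rewrite !mulf_eq0 (negbTE c0) /= => /eqP l0 /eqP o0; move: nc; rewrite l0 o0 eqxx.
split=> //; split=> //.
- by apply: (mulfI D0); rewrite mulr0 mulrA.
- by rewrite (PE 1 0 _ _ _ aE); ring.
- by rewrite (PE 0 1 _ _ _ bE); ring.
Qed.

End Classification.

(** * Normal forms *)

Definition cyc (n : nat) : magma := @Magma 'Z_n (fun x y => x + y)%R 0%R.

Section Cyclic.
Variable p : nat.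
Hypothesis (pp : prime p).

Lemma p3_gt1 : 1 < p ^ 3.
Proof. by rewrite -{1}(exp1n 3) ltn_exp2r // prime_gt1. Qed.

Lemma card_cyc : #|mcar (cyc (p ^ 3))| = p ^ 3.
Proof. by rewrite card_ord Zp_cast // p3_gt1. Qed.

Lemma cyc_loop n : is_loop (cyc n).
Proof.
split; last split.
- by move=> x; rewrite /= add0r addr0.
- by move=> a; apply: injF_bij => x y /addrI.
- by move=> a; apply: injF_bij => x y /addIr.
Qed.

Lemma cyc_bol n : right_bol (cyc n).
Proof. by move=> x y z; rewrite /= !addrA. Qed.

Lemma cyc_cn n : centrally_nilpotent (cyc n).
Proof.
apply: cn_abelian; first exact: cyc_loop.
by apply: center_setT => [x y|x y z]; rewrite /= ?addrA // addrC.
Qed.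

Lemma cyc_pow n (x : 'Z_n) k : pow (x : mcar (cyc n)) k = (x *+ k)%R.
Proof. by elim: k => // k IH; rewrite powS IH mulrSr. Qed.

Lemma cyc_iso (M : magma) (a : mcar M) : is_loop M -> right_bol M ->
  #|mcar M| = p ^ 3 -> ord a = p ^ 3 -> isomorphic M (cyc (p ^ 3)).
Proof.
move=> loopM bolM cM oa; apply: iso_sym; pose g (k : 'Z_(p ^ 3)) := pow a k.
have gI : injective g.
  have lt (k : 'Z_(p ^ 3)) : k < ord a by rewrite oa -{2}(Zp_cast p3_gt1) ltn_ord.
  by move=> k l /(pow_inj (lt k) (lt l)) E; apply: val_inj.
exists g; split.
  by apply: (@inj_card_bij _ _ g gI); rewrite cM card_cyc.
move=> k l; rewrite /g powD // [RHS]pow_mod // oa; congr (pow a).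
by rewrite /= {3}Zp_cast // p3_gt1.
Qed.

(** Separates the cyclic loop from the models, where every p^2-th power is trivial. *)
Lemma cyc_pow_neq1 : pow (1%R : mcar (cyc (p ^ 3))) (p * p) <> mone _.
Proof.
rewrite cyc_pow => /(congr1 val) /=; rewrite val_Zp_nat ?p3_gt1 //.
rewrite mulnn modn_small ?ltn_exp2l ?prime_gt1 // => /eqP.
by rewrite expn_eq0 andbT => /eqP p0; move: pp; rewrite p0.
Qed.

End Cyclic.

(** * The list of normal forms has no two isomorphic members *)

Section Counting.
Variable p : nat.
Hypotheses (pp : prime p) (podd : odd p).
Local Notation F := 'F_p.
Local Open Scope ring_scope.
Local Notation two := (Fp_two_neq0 pp podd).
Implicit Types lam om ga al be : F.

(* The shift by [eps] makes a parameter transform uniformly in [p]: [eps] is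
   nonzero only for [p = 3], where the cube map [Q / <z> -> <z>] need not be additive. *)
Definition interp (t : F * F * F * F) : magma :=
  let: (lam, om, ga, al) := t in model lam om al (ga - eps p * lam).

Definition canon (nu : F) (t : F * F * F * F) : Prop :=
  let: (lam, om, ga, al) := t in
  [/\ lam = 0 \/ lam = 1, om = 0 \/ om = 1, al = 0 \/ al = 1 &
   [/\ lam = 0 -> ga = 0, ga <> 0 -> al = 0 &
       om = 0 -> [\/ ga = 0, ga = 1 | ga = nu]]].

(** The first four entries are the noncyclic groups of order p^3; the entries with [lam] = 1 are
    nonassociative. When [om] = 0, [ga] counts only up to squares, whence [nu]. *)
Definition params (nu : F) : seq (F * F * F * F) :=
  [:: (0, 0, 0, 0); (0, 0, 0, 1); (0, 1, 0, 0); (0, 1, 0, 1);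
      (1, 0, 0, 0); (1, 0, 0, 1); (1, 0, 1, 0); (1, 0, nu, 0);
      (1, 1, 0, 0); (1, 1, 0, 1)] ++
  [seq (1, 1, g, 0) | g <- enum F & g != 0].

Lemma iso_pow_e M M' n : is_loop M -> is_loop M' -> isomorphic M M' ->
  (forall x : mcar M, pow x n = mone M) -> forall x : mcar M', pow x n = mone M'.
Proof.
move=> loopM loopM' [f [[g gK Kg] fM]] E x.
by rewrite -[x]Kg -(hom_pow loopM loopM' fM) E (hom1 loopM loopM' fM).
Qed.

Lemma iso_comm M M' : isomorphic M M' ->
  (forall x y : mcar M, x ** y = y ** x) -> forall x y : mcar M', x ** y = y ** x.
Proof. by move=> [f [[g gK Kg] fM]] C x y; rewrite -[x]Kg -[y]Kg -!fM C. Qed.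

Lemma size_params nu : size (params nu) = (p + 9)%N.
Proof.
rewrite size_cat size_map size_filter -[(size _ + _)%N]/(1 + 9 + _)%N addnAC; congr (_ + 9)%N.
have := count_predC (pred1 (0 : F)) (enum F); rewrite -cardE card_Fp //.
by rewrite (count_uniq_mem _ (enum_uniq F)) mem_enum.
Qed.

Lemma canon_params nu t : t \in params nu -> canon nu t.
Proof.
have n10 : 1 <> 0 :> F by apply/eqP; rewrite oner_eq0.
rewrite mem_cat => /orP[|/mapP[g]]; last first.
  rewrite mem_filter => /andP[g0 _] ->.
  by split; [right|right|left|split=> // /n10].
rewrite !inE => H; do ?[case/orP: H => H]; move/eqP: H => ->;
  (split; [| | |split]); auto using Or31, Or32, Or33; by move=> // /n10.
Qed.

Lemma uniq_params nu : nu != 0 -> nu != 1 -> uniq (params nu).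
Proof.
move=> nu0 nu1; rewrite cat_uniq; apply/and3P; split.
- by rewrite /= !inE !xpair_eqE !eqxx !(eq_sym 0 1) !oner_eq0 /= !(eq_sym 0 nu) !(eq_sym 1 nu)
    (negbTE nu0) (negbTE nu1).
- apply/hasPn => t /mapP[g]; rewrite mem_filter => /andP[g0 _] ->.
  by rewrite !inE !xpair_eqE !eqxx !(eq_sym 0 1) !oner_eq0 /= (negbTE g0).
- rewrite map_inj_uniq; first by rewrite filter_uniq // enum_uniq.
  by move=> g h /= [].
Qed.

Lemma comm_params lam om al be lam' om' al' be' :
  isomorphic (model lam om al be) (model lam' om' al' be') ->
  (lam != 0) || (om != 0) = false -> (lam' != 0) || (om' != 0) = false.
Proof.
move=> iso /negbT; rewrite negb_or !negbK => /andP[/eqP l0 /eqP o0].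
have [-> ->] := model_commP pp podd (iso_comm iso (@model_comm0 p pp lam om al be l0 o0)).
by rewrite eqxx.
Qed.

(** Under these conditions all p-th powers are trivial in the first loop, hence in the second, where
    (1,0,0) has p-th power (0,0,al'). *)
Lemma exp_params lam om al lam' om' al' :
  isomorphic (model lam om al 0) (model lam' om' al' 0) -> lam = 0 -> al = 0 -> al' = 0.
Proof.
move=> iso l0 a0; have L := model_loop pp lam om al 0; have L' := model_loop pp lam' om' al' 0.
have E := iso_pow_e (n := p) L L' iso.
have : pow ((1, 0, 0) : mcar (model lam' om' al' 0)) p = mone _.
  apply: E => -[[i j] c]; rewrite model_powp // l0 a0; congr (_, _, _); ring.
by rewrite model_powp // => /triple_inj[_ _]; rewrite mulr1 !mulr0 !addr0.
Qed.

Lemma zero_one_eq (a b : F) : a = 0 \/ a = 1 -> b = 0 \/ b = 1 ->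
  (a = 0 -> b = 0) -> (b = 0 -> a = 0) -> a = b.
Proof. by move=> [->|->] [->|->] // H1 H2; [rewrite H1|rewrite H2]. Qed.

(** Models with [lam] = 0 are separated by commutativity and exponent. For [lam] = 1 on both sides
    the invariants give om' = y1 om and ga' = y1^2 ga, and when [ga] = 0 the vanishing of [al] is
    also invariant. *)
Lemma canon_inj nu t t' : (forall h : F, h ^+ 2 <> nu) ->
  canon nu t -> canon nu t' -> isomorphic (interp t) (interp t') -> t = t'.
Proof.
case: t t' => [[[lam om] ga] al] [[[lam' om'] ga'] al'] nsq.
move=> [lamE omE alE [gl ga_al gE]] [lamE' omE' alE' [gl' ga_al' gE']] /= iso.
have iso' := iso_sym iso.
case nc : ((lam != 0) || (om != 0)); case nc' : ((lam' != 0) || (om' != 0)); last first.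
- move: nc nc' => /negbT + /negbT; rewrite !negb_or !negbK.
  move=> /andP[/eqP l0 /eqP o0] /andP[/eqP l0' /eqP o0'].
  have g0 := gl l0; have g0' := gl' l0'; subst lam om ga lam' om' ga'.
  rewrite mulr0 subr0 in iso iso'; congr (_, _).
  by apply: zero_one_eq => // ?; [apply: (exp_params iso)|apply: (exp_params iso')].
- by rewrite (comm_params iso nc) in nc'.
- by rewrite (comm_params iso' nc') in nc.
have [y1 [y2 [w1 [w2 [c [c0 D0 [Ew Ey Eo Pa Pb]]]]]]] := model_iso_inv pp podd nc nc' iso.
case: lamE => l0; subst lam.
  (* Otherwise w1 = 0 and y1 = 0, which makes the determinant vanish. *)
  have lam'0 : lam' = 0.
    case: lamE' => // l1; move: Ew Ey; rewrite l1 mul1r mulr0 mulr1 => w10 /eqP.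
    rewrite mulf_eq0 (negbTE D0) /= => /eqP y10.
    by move: D0; rewrite w10 y10 mul0r mulr0 subr0 eqxx.
  subst lam'; have g0 := gl erefl; have g0' := gl' erefl; subst ga ga'.
  rewrite mulr0 subr0 in iso iso'.
  have -> : om = om' by move: nc nc'; rewrite eqxx /=; case: omE omE' => [->|->] [->|->]; rewrite ?eqxx.
  congr (_, _).
  by apply: zero_one_eq => // ?; [apply: (exp_params iso)|apply: (exp_params iso')].
have l1 : lam' = 1.
  case: lamE' => // l0; move: Ey; rewrite l0 mulr0 mul0r mulr1 => /esym/eqP.
  by rewrite (negbTE c0).
subst lam'; rewrite mul1r in Ew; subst w1; rewrite mulr0 subr0 !mulr1 in Ey Eo D0 Pa Pb.
have y0 : y1 != 0 by apply: contraNneq D0 => ->; rewrite mul0r.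
have w0 : w2 != 0 by apply: contraNneq D0 => ->; rewrite mulr0.
have omy : om' = y1 * om.
  by apply: (mulfI D0); rewrite Eo -Ey mulrA.
have gay : ga' = y1 ^+ 2 * ga.
  have : ga' - eps p = y1 ^+ 2 * (ga - eps p).
    apply: (mulIf w0); move: Pb; rewrite expr0n /= !(mulr0, mul0r, addr0, add0r) => ->.
    by rewrite -Ey; ring.
  by rewrite mulrBr [_ * eps p]mulrC eps_sq // => /addIr.
have Pa' : al' * y1 + ga' * y2 = c * al.
  by rewrite -Pa eps_sq // -addrA -mulrDl subrK.
have omE1 : om = om'.
  rewrite omy; case: omE => o; rewrite o ?mulr0 // mulr1.
  by case: omE' => o'; move: omy; rewrite o' o mulr1 => // /esym/eqP; rewrite (negbTE y0).
(* If [om] = 1 then y1 = 1; if [om] = 0, no two of 0, 1, [nu] differ by a nonzero square factor. *)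
have gaE : ga = ga'.
  case: omE => o; last first.
    by move: omy; rewrite -omE1 o mulr1 gay => <-; rewrite expr1n mul1r.
  have o' : om' = 0 by rewrite -omE1.
  case: (gE o) (gE' o') => [g0|g1|gn] [g0'|g1'|gn']; rewrite ?g0 ?g1 ?gn ?g0' ?g1' ?gn' // in gay *.
  - by move: gay => /eqP; rewrite mulr0 oner_eq0.
  - by rewrite gay mulr0.
  - by move/esym/eqP: gay; rewrite mulr1 sqrf_eq0 (negbTE y0).
  - by case: (nsq y1); rewrite gay mulr1.
  - by move/esym/eqP: gay; rewrite mulf_eq0 sqrf_eq0 (negbTE y0) /= => /eqP.
  - case: (nsq y1^-1); apply: (mulfI (expf_neq0 2 y0)).
    by rewrite exprVn divff ?expf_neq0.
rewrite -omE1 -gaE; congr (_, _).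
have [g0|/eqP g0] := eqVneq ga 0; last by rewrite ga_al // ga_al' // -gaE.
move: Pa'; rewrite -gaE g0 mul0r addr0 => Pa'.
apply: zero_one_eq => // a0; move: Pa'; rewrite a0 ?mulr0 ?mul0r.
  by move/eqP; rewrite mulf_eq0 (negbTE y0) orbF => /eqP.
by move/esym/eqP; rewrite mulf_eq0 (negbTE c0) => /eqP.
Qed.

End Counting.

(** * Every model reaches a normal form *)

Section Completeness.
Variable p : nat.
Hypotheses (pp : prime p) (podd : odd p).
Local Notation F := 'F_p.
Local Open Scope ring_scope.
Implicit Types lam om ga al be : F.

Lemma iso_model_eq M (a b c d a' b' c' d' : F) : isomorphic M (model a b c d) ->
  a = a' -> b = b' -> c = c' -> d = d' -> isomorphic M (model a' b' c' d').
Proof. by move=> iso <- <- <- <-. Qed.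

(** Here r = 0, and z is rescaled by k^2 d precisely so that [lam] stays 1. The shift by [eps]
    survives division by k^2 thanks to [eps_sq]. *)
Lemma interp_change om ga al (k s d : F) : k != 0 -> d != 0 ->
  isomorphic (interp (1, om, ga, al)) (interp (1, om / k, ga / k ^+ 2, (k * al + s * ga) / (k ^+ 2 * d))).
Proof.
move=> k0 d0; have k2 : k ^+ 2 != 0 by rewrite expf_neq0.
have := @model_change p pp podd 1 om al (ga - eps p * 1) k s 0 d (k ^+ 2 * d).
rewrite !mulr0 subr0 !mulr1 !mulf_neq0 // => /(_ isT isT erefl) H.
have ek : eps p * k ^+ 2 = eps p := eps_sq pp podd k0.
rewrite /interp mulr1; apply: (iso_model_eq H).
- rewrite (_ : k * d * k = k ^+ 2 * d); last by ring.
  by rewrite divff // mulf_neq0.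
- by field; apply/andP.
- by congr (_ / _); rewrite ek; ring.
- rewrite add0r -mulf_div divff // mulr1 mulrBl; congr (_ - _).
  by rewrite -{1}ek mulfK.
Qed.

Lemma model_scale lam om al be : lam != 0 ->
  isomorphic (model lam om al be) (model 1 (om / lam) (al / lam) (be / lam)).
Proof.
move=> l0; have := @model_change p pp podd lam om al be 1 0 0 1 lam.
by rewrite !mulr0 subr0 !mulr1 !mul1r oner_eq0 !addr0 add0r divff //; apply.
Qed.

(** With [lam] = 0 the p-th power map is the linear form (al, be). If it is nonzero, the second
    generator is taken in its kernel and [z] becomes the p-th power of the first. *)
Lemma model_flat lam om al be : lam = 0 -> exists om' al', [/\ om' = 0 \/ om' = 1, al' = 0 \/ al' = 1 &
  isomorphic (model lam om al be) (model 0 om' al' 0)].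
Proof.
move=> l0; rewrite {lam}l0.
have flat (k s r d c : F) : k * d - s * r != 0 -> c != 0 ->
    isomorphic (model 0 om al be)
      (model 0 ((k * d - s * r) * om / c) ((al * k + be * s) / c) ((al * r + be * d) / c)).
  move=> D0 c0; have := model_change pp podd om al be D0 c0 (mul0r r).
  by rewrite !mulr0 !mul0r addr0.
have [/andP[/eqP a0 /eqP b0]|ab] := boolP ((al == 0) && (be == 0)).
  have [o0|o0] := eqVneq om 0.
    exists 0, 0; split; [by left|by left|].
    have := flat 1 0 0 1 1; rewrite o0 a0 b0 !(mulr1, mulr0, mul0r, subr0, addr0).
    by apply; rewrite oner_eq0.
  exists 1, 0; split; [by right|by left|].
  have := flat 1 0 0 1 om; rewrite a0 b0 !(mulr1, mul1r, mulr0, mul0r, subr0, addr0) divff //.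
  by apply; rewrite // oner_eq0.
have [k [s q0]] : exists k s, al * k + be * s != 0.
  move: ab; rewrite negb_and => /orP[a0|b0].
    by exists 1, 0; rewrite mulr1 mulr0 addr0.
  by exists 0, 1; rewrite mulr1 mulr0 add0r.
(* The scale [h] of the kernel vector (-be, al) is chosen to bring [om] to 0 or 1. *)
pose h : F := if om == 0 then 1 else om^-1.
have h0 : h != 0 by rewrite /h; case: (eqVneq om 0) => [_|o0]; rewrite ?oner_eq0 ?invr_eq0.
have DE : k * (h * al) - s * (- (h * be)) = h * (al * k + be * s) by ring.
exists (h * om), 1; split; [|by right|].
  by rewrite /h; case: (eqVneq om 0) => [->|o0]; [left; rewrite mulr0|right; rewrite mulVf].
have D0 : k * (h * al) - s * (- (h * be)) != 0 by rewrite DE mulf_neq0.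
apply: (iso_model_eq (flat _ _ _ _ _ D0 q0)) => //.
- by rewrite DE mulrAC mulfK.
- by rewrite divff.
- by rewrite (_ : _ + _ = 0) ?mul0r //; ring.
Qed.

Lemma mem_params (nu : F) t : t \in take 10 (params nu) -> t \in params nu.
Proof. exact: mem_take. Qed.

Lemma model_canon (nu : F) lam om al be :
  (forall g : F, g != 0 -> exists2 h, h != 0 & g = h ^+ 2 \/ g = nu * h ^+ 2) ->
  exists2 t, t \in params nu & isomorphic (model lam om al be) (interp t).
Proof.
move=> sq; have [l0|l0] := eqVneq lam 0.
  have [om' [al' [oE aE iso]]] := model_flat om al be l0.
  exists (0, om', 0, al'); last by rewrite /interp mulr0 subr0.
  by apply: mem_params; case: oE aE => -> [->|->]; rewrite /= !inE eqxx ?orbT.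
suff {om al be} H om ga al : exists2 t, t \in params nu & isomorphic (interp (1, om, ga, al)) (interp t).
  have [t tP iso] := H (om / lam) (be / lam + eps p) (al / lam).
  exists t => //; apply: iso_trans (model_scale om al be l0) _.
  by move: iso; rewrite /interp mulr1 addrK.
have [g0|g0] := eqVneq ga 0; last first.
  (* When [ga] is nonzero, s = -(k al)/ga removes [al]; the factor k remains free to normalize [om],
     or [ga] up to squares. *)
  have kill k : k != 0 -> isomorphic (interp (1, om, ga, al)) (interp (1, om / k, ga / k ^+ 2, 0)).
    move=> k0; have := interp_change om ga al (- (k * al) / ga) k0 (oner_neq0 _).
    by rewrite divfK // subrr mul0r.
  have [o0|o0] := eqVneq om 0.
    have [h h0 [gE|gE]] := sq ga g0.
      exists (1, 0, 1, 0); first by apply: mem_params; rewrite /= !inE eqxx ?orbT.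
      by have := kill h h0; rewrite o0 mul0r {2}gE divff // expf_neq0.
    exists (1, 0, nu, 0); first by apply: mem_params; rewrite /= !inE eqxx ?orbT.
    by have := kill h h0; rewrite o0 mul0r {2}gE mulfK // expf_neq0.
  exists (1, 1, ga / om ^+ 2, 0); last by have := kill om o0; rewrite divff.
  rewrite mem_cat; apply/orP; right; apply/mapP; exists (ga / om ^+ 2) => //.
  by rewrite mem_filter mem_enum andbT mulf_neq0 // invr_eq0 expf_neq0.
subst ga.
have scale k d : k != 0 -> d != 0 ->
    isomorphic (interp (1, om, 0, al)) (interp (1, om / k, 0, (k * al) / (k ^+ 2 * d))).
  by move=> k0 d0; have := interp_change om 0 al 0 k0 d0; rewrite mulr0 addr0 mul0r.
have [om' [k k0 [oE omk]]] : exists om', exists2 k, k != 0 & (om' = 0 \/ om' = 1) /\ om / k = om'.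
  have [o0|o0] := eqVneq om 0.
    by exists 0, 1; rewrite ?oner_eq0 //; split; [left|rewrite o0 mul0r].
  by exists 1, om => //; split; [right|rewrite divff].
have [al' [d d0 [aE ald]]] : exists al', exists2 d, d != 0 & (al' = 0 \/ al' = 1) /\ (k * al) / (k ^+ 2 * d) = al'.
  have [a0|a0] := eqVneq al 0.
    by exists 0, 1; rewrite ?oner_eq0 //; split; [left|rewrite a0 mulr0 mul0r].
  (* With [ga] = 0 the parameter [al] becomes al/(k d), so d = al/k turns it into 1. *)
  exists 1, (al / k); first by rewrite mulf_neq0 // invr_eq0.
  split; [by right|rewrite (_ : k ^+ 2 * _ = k * al) ?divff ?mulf_neq0 //].
  by rewrite expr2 -mulrA [k * (al / k)]mulrC divfK.
exists (1, om', 0, al'); last by rewrite -omk -ald; apply: scale.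
by apply: mem_params; case: oE aE => -> [->|->]; rewrite /= !inE eqxx ?orbT.
Qed.

Lemma count_cn_right_bol_p3 :
  num_iso_classes (fun M => cn_right_bol_loop M /\ #|mcar M| = (p ^ 3)%N) (p + 10).
Proof.
have [nu [nsq sq]] := nonsquare pp podd.
have nu0 : nu != 0 by apply/eqP => nu0; apply: (nsq 0); rewrite nu0 expr0n.
have nu1 : nu != 1 by apply/eqP => nu1; apply: (nsq 1); rewrite nu1 expr1n.
(* Index 0 is the cyclic group; the p + 9 models follow, shifted by one. *)
pose Ls := cyc (p ^ 3) :: [seq interp t | t <- params nu].
have nthS (i : nat) : (i < p + 9)%N -> nth (cyc (p ^ 3)) Ls i.+1 = interp (nth (0, 0, 0, 0) (params nu) i).
  by move=> lt; apply: (nth_map (0, 0, 0, 0)); rewrite size_params.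
have inP (i : nat) : (i < p + 9)%N -> nth (0, 0, 0, 0) (params nu) i \in params nu.
  by move=> lt; rewrite mem_nth ?size_params.
have notcyc (t : F * F * F * F) : ~ isomorphic (interp t) (cyc (p ^ 3)).
  case: t => [[[lam om] ga] al] iso; apply: (@cyc_pow_neq1 p pp).
  have L : is_loop (interp (lam, om, ga, al)) := model_loop pp _ _ _ _.
  apply: (@iso_pow_e _ _ (p * p) L (@cyc_loop _) iso) => -[[i j] c]; rewrite /interp in L *.
  by rewrite -powM //; [rewrite !model_powp // !mulr0 !addr0|exact: model_bol].
exists (fun i : 'I_(p + 10) => nth (cyc (p ^ 3)) Ls i); split.
- case=> [[|i] lt]; first by split; [split; [exact: cyc_loop|exact: cyc_bol|exact: cyc_cn]|exact: card_cyc].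
  rewrite [nat_of_ord _]/= nthS; last by rewrite addnS ltnS in lt.
  case: (nth _ _ i) => [[[lam om] ga] al]; split; last exact: card_model.
  by split; [exact: model_loop|exact: model_bol|exact: model_cn].
- case=> [[|i] lti] [[|j] ltj] iso; apply: val_inj => //=; rewrite [nat_of_ord _]/= in iso.
  + by rewrite [nat_of_ord _]/= nthS in iso; [case: (notcyc _ (iso_sym iso))|rewrite addnS ltnS in ltj].
  + by rewrite [nat_of_ord _]/= nthS in iso; [case: (notcyc _ iso)|rewrite addnS ltnS in lti].
  rewrite [nat_of_ord (Ordinal ltj)]/= in iso.
  rewrite addnS ltnS in lti; rewrite addnS ltnS in ltj.
  rewrite !nthS // in iso; congr _.+1; apply/eqP.
  rewrite -(nth_uniq (0, 0, 0, 0) _ _ (uniq_params nu0 nu1)) ?size_params //; apply/eqP.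
  by apply: (canon_inj pp podd nsq _ _ iso); apply/canon_params/inP.
move=> M [[loopM bolM cnM] cM].
have [[a oa]|[z S]] := cyclic_or_setup loopM bolM pp cM cnM.
  have lt : (0 < p + 10)%N by rewrite addnS.
  by exists (Ordinal lt); apply: (cyc_iso pp loopM bolM cM oa).
have [lam [om [al [be iso]]]] := setup_model pp podd loopM bolM S cM.
have [t tP iso'] := model_canon lam om al be sq.
have lt : ((index t (params nu)).+1 < p + 10)%N.
  by rewrite addnS ltnS -(size_params pp nu) index_mem.
exists (Ordinal lt); rewrite [nat_of_ord _]/= nthS; last by rewrite addnS ltnS in lt.
by rewrite nth_index //; apply: iso_trans iso iso'.
Qed.

End Completeness.

Theorem theorem5p1 :
  [/\ num_iso_classes (fun M => cn_right_bol_loop M /\ #|mcar M| = 3 ^ 3) 13,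
      num_iso_classes (fun M => cn_right_bol_loop M /\ #|mcar M| = 5 ^ 3) 15 &
      num_iso_classes (fun M => cn_right_bol_loop M /\ #|mcar M| = 7 ^ 3) 17].
Proof.
by split; [exact: (@count_cn_right_bol_p3 3)|exact: (@count_cn_right_bol_p3 5)
          |exact: (@count_cn_right_bol_p3 7)].
Qed.
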